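(* (1) If $(\mathbf{M},1,\otimes,\{\Phi_{(f',g'),(f,g)}\})$ is a semistrict monoidal 2-category, then restricting to the underlying interchangor 2-isomorphisms $\phi_{f,g}:=\Phi_{(f,\mathrm{id}),(\mathrm{id},g)}$ gives a stringent monoidal 2-category. (2) If $(\mathbf{M},1,\otimes,\{\phi_{f,g}\})$ is a stringent monoidal 2-category, then the interchangor 2-isomorphisms $\phi_{f,g}$ can be extended to coherence isomorphisms $\Phi_{(f',g'),(f,g)}$ making $\mathbf{M}$ into a semistrict monoidal 2-category. (3) The processes in (1) and (2) are inverse to each other, on the nose.
   Context: Conventions. A 2-category is a strict bicategory. $\circ$ denotes composition of 1-morphisms and vertical composition of 2-morphisms, and $\ast$ denotes horizontal composition (whiskering). Cubical functor. For 2-categories $\mathbf{C},\mathbf{C}',\mathbf{D}$, a cubical functor $F\colon\mathbf{C}\times\mathbf{C}'\to\mathbf{D}$ is a pseudofunctor whose coherence isomorphisms $\Phi_{(f',g'),(f,g)}\colon F(f',g')\circ F(f,g)\Rightarrow F(f'f,g'g)$ are the identity 2-morphism if $f'=\mathrm{id}$ or if $g=\mathrm{id}$. Unit coherence 2-isomorphisms $\mathrm{id}_{F(A,B)}\Rightarrow F(\mathrm{id}_A,\mathrm{id}_B)$ are not listed as part of the data, each of them being the identity. Semistrict monoidal 2-category. It is a monoid $(\mathbf{M},1,\otimes,\{\Phi_{(f',g'),(f,g)}\})$ in the monoidal category of (strict) 2-categories and pseudofunctors under cartesian product, whose tensor product pseudofunctor $(\otimes,\Phi)\colon\mathbf{M}\times\mathbf{M}\to\mathbf{M}$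 is cubical. For $f\colon A\to A'$ and $g\colon B\to B'$, the target of $\Phi_{(f,\mathrm{id}_{B'}),(\mathrm{id}_A,g)}$ is $f\otimes g=(\mathrm{id}_{A'}\otimes g)\circ(f\otimes\mathrm{id}_B)$, since $\Phi_{(\mathrm{id},g),(f,\mathrm{id})}$ is an identity. So the underlying interchangor is a collection of 2-isomorphisms $\phi_{f,g}\colon(f\otimes\mathrm{id}_{B'})\circ(\mathrm{id}_A\otimes g)\Rightarrow(\mathrm{id}_{A'}\otimes g)\circ(f\otimes\mathrm{id}_B)$. Stringent monoidal 2-category $(\mathbf{M},1,\otimes,\{\phi_{f,g}\})$. It consists of a 2-category $\mathbf{M}$ with the following data and axioms. (i) An object $1\in\mathbf{M}$. (ii) For any two objects $A,B$, an object $A\otimes B$. (iii) The tensor product of objects is strictly associative and unital. For each object $A$ it extends to strict 2-functors $L_A=A\otimes-$ and $R_A=-\otimes A$ from $\mathbf{M}$ to itself, with $L_AL_B=L_{A\otimes B}$, $R_BR_A=R_{A\otimes B}$ and $L_AR_B=R_BL_A$ for all $A,B$ (and, $1$ being a strict unit, $L_1=R_1=\mathrm{Id}$). For a 1-morphism $f$ write $f\otimes\mathrm{id}_B:=R_B(f)$ and $\mathrm{id}_B\otimes f:=L_B(f)$; for a 2-morphism $\alpha$ write $\alpha\otimes B:=R_B(\alpha)$ and $B\otimes\alpha:=L_B(\alpha)$. (iv) For all $f\colon A\to A'$ and $g\colon B\to B'$, an interchangor 2-isomorphism $\phi_{f,g}\colon(f\otimes\mathrm{id}_{B'})\circ(\mathrm{id}_A\otimes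 g)\Rightarrow(\mathrm{id}_{A'}\otimes g)\circ(f\otimes\mathrm{id}_B)$. (v) (Nudging.) For all $f\colon A\to A'$ and $g\colon B\to B'$, $(\mathrm{id}_{A'}\otimes g)\circ(f\otimes\mathrm{id}_B)=f\otimes g$. (The tensor product of two 1-morphisms is thus given by the functors $L,R$, and that of 2-morphisms accordingly.) (vi) For all $f\colon A\to A'$, $g\colon B\to B'$, $h\colon C\to C'$: $\phi_{\mathrm{id}_A\otimes g,h}=A\otimes\phi_{g,h}$, $\phi_{f\otimes\mathrm{id}_B,h}=\phi_{f,\mathrm{id}_B\otimes h}$, and $\phi_{f,g\otimes\mathrm{id}_C}=\phi_{f,g}\otimes C$. (vii) For all 1-morphisms $f,g$: $\phi_{f,\mathrm{id}}=\mathrm{id}$ and $\phi_{\mathrm{id},g}=\mathrm{id}$. (viii) For $\alpha\colon f\Rightarrow f'$ with $f,f'\colon A\to A'$, and $g\colon B\to B'$: $\phi_{f',g}\circ\big((\alpha\otimes B')\ast\mathrm{id}_{\mathrm{id}_A\otimes g}\big)=\big(\mathrm{id}_{\mathrm{id}_{A'}\otimes g}\ast(\alpha\otimes B)\big)\circ\phi_{f,g}$. Similarly for $\beta\colon g\Rightarrow g'$: $\phi_{f,g'}\circ\big(\mathrm{id}_{f\otimes\mathrm{id}_{B'}}\ast(A\otimes\beta)\big)=\big((A'\otimes\beta)\ast\mathrm{id}_{f\otimes\mathrm{id}_B}\big)\circ\phi_{f,g}$. (ix) For $f\colon A\to A'$, $g\colon B\to B'$, $g'\colon B'\to B''$: $\phi_{f,g'g}=(\mathrm{id}_{\mathrm{id}_{A'}\otimes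 g'}\ast\phi_{f,g})\circ(\phi_{f,g'}\ast\mathrm{id}_{\mathrm{id}_A\otimes g})$. Correspondingly, for $f\colon A\to A'$, $f'\colon A'\to A''$, $g\colon B\to B'$: $\phi_{f'f,g}=(\phi_{f',g}\ast\mathrm{id}_{f\otimes\mathrm{id}_B})\circ(\mathrm{id}_{f'\otimes\mathrm{id}_{B'}}\ast\phi_{f,g})$. *)

(* Defs.v *)
From Stdlib Require Import Eqdep.

Set Implicit Arguments.
Unset Strict Implicit.

Declare Scope twocat_scope.
Delimit Scope twocat_scope with twocat.
Local Open Scope twocat_scope.

Record twocat_data := TwocatData {
  ob : Type;
  hom : ob -> ob -> Type;
  cell : forall A B : ob, hom A B -> hom A B -> Type;
  id1 : forall A : ob, hom A A;
  comp1 : forall A B C : ob, hom B C -> hom A B -> hom A C;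
  id2 : forall (A B : ob) (f : hom A B), cell f f;
  vcomp : forall (A B : ob) (f g h : hom A B), cell g h -> cell f g -> cell f h;
  hcomp : forall (A B C : ob) (g g' : hom B C) (f f' : hom A B),
    cell g g' -> cell f f' -> cell (comp1 g f) (comp1 g' f') }.

Arguments hom {t} A B : rename.
Arguments cell {t A B} f g : rename.
Arguments id1 {t} A : rename.
Arguments comp1 {t A B C} g f : rename.
Arguments id2 {t A B} f : rename.
Arguments vcomp {t A B f g h} b a : rename.
Arguments hcomp {t A B C g g' f f'} b a : rename.

Notation "g 'o1' f" := (comp1 g f) (at level 40, left associativity) : twocat_scope.
Notation "b 'o2' a" := (vcomp b a) (at level 40, left associativity) : twocat_scope.
Notation "b '**' a" := (hcomp b a) (at level 39, left associativity) : twocat_scope.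

(** 1-morphisms (2-morphisms) whose boundaries agree only up to a propositional
    equality are compared after being packed together with their boundaries. *)
Record mor1 (M : twocat_data) := Mor1 {
  mor1_src : ob M;
  mor1_tgt : ob M;
  mor1_hom : hom mor1_src mor1_tgt }.

Record mor2 (M : twocat_data) := Mor2 {
  mor2_src0 : ob M;
  mor2_tgt0 : ob M;
  mor2_src : hom mor2_src0 mor2_tgt0;
  mor2_tgt : hom mor2_src0 mor2_tgt0;
  mor2_cell : cell mor2_src mor2_tgt }.

Arguments Mor1 {M mor1_src mor1_tgt} mor1_hom.
Arguments Mor2 {M mor2_src0 mor2_tgt0 mor2_src mor2_tgt} mor2_cell.

Notation "f =1= g" := (Mor1 f = Mor1 g) (at level 70, no associativity) : twocat_scope.
Notation "a =2= b" := (Mor2 a = Mor2 b) (at level 70, no associativity) : twocat_scope.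

(** Since [f] and [g] are part of [Mor2 a], this includes [f = g]. *)
Definition is_id2 (M : twocat_data) (A B : ob M) (f g : hom A B) (a : cell f g) : Prop :=
  a =2= id2 f.

Definition is_iso2 (M : twocat_data) (A B : ob M) (f g : hom A B) (a : cell f g) : Prop :=
  exists b : cell g f, b o2 a = id2 f /\ a o2 b = id2 g.

Record is_twocat (M : twocat_data) : Prop := IsTwocat {
  comp1_assoc : forall (A B C D : ob M) (h : hom C D) (g : hom B C) (f : hom A B),
    h o1 g o1 f = h o1 (g o1 f);
  comp1_idl : forall (A B : ob M) (f : hom A B), id1 B o1 f = f;
  comp1_idr : forall (A B : ob M) (f : hom A B), f o1 id1 A = f;
  vcomp_assoc : forall (A B : ob M) (f g h k : hom A B)
    (c : cell h k) (b : cell g h) (a : cell f g), c o2 b o2 a = c o2 (b o2 a);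
  vcomp_idl : forall (A B : ob M) (f g : hom A B) (a : cell f g), id2 g o2 a = a;
  vcomp_idr : forall (A B : ob M) (f g : hom A B) (a : cell f g), a o2 id2 f = a;
  hcomp_id2 : forall (A B C : ob M) (g : hom B C) (f : hom A B),
    id2 g ** id2 f = id2 (g o1 f);
  hcomp_vcomp : forall (A B C : ob M) (g g' g'' : hom B C) (f f' f'' : hom A B)
    (b' : cell g' g'') (b : cell g g') (a' : cell f' f'') (a : cell f f'),
    (b' o2 b) ** (a' o2 a) = (b' ** a') o2 (b ** a);
  hcomp_assoc : forall (A B C D : ob M) (h h' : hom C D) (g g' : hom B C) (f f' : hom A B)
    (c : cell h h') (b : cell g g') (a : cell f f'), c ** b ** a =2= c ** (b ** a);
  hcomp_idl : forall (A B : ob M) (f f' : hom A B) (a : cell f f'),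
    id2 (id1 B) ** a =2= a;
  hcomp_idr : forall (A B : ob M) (f f' : hom A B) (a : cell f f'),
    a ** id2 (id1 A) =2= a }.

Record twocat := Twocat {
  twocat_base :> twocat_data;
  twocatP : is_twocat twocat_base }.

(** The identity 2-morphism between two equal 1-morphisms; it is inserted in
    vertical composites whose middle boundaries agree only by associativity. *)
Definition eq_cell (M : twocat_data) (A B : ob M) (f g : hom A B) (e : f = g) : cell f g :=
  match e in _ = g' return cell f g' with eq_refl => id2 f end.

Definition assoc_cell (M : twocat) (A B C D : ob M)
    (h : hom C D) (g : hom B C) (f : hom A B) : cell (h o1 g o1 f) (h o1 (g o1 f)) :=
  eq_cell (comp1_assoc (twocatP M) h g f).

Definition assoc_cell_inv (M : twocat) (A B C D : ob M)
    (h : hom C D) (g : hom B C) (f : hom A B) : cell (h o1 (g o1 f)) (h o1 g o1 f) :=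
  eq_cell (eq_sym (comp1_assoc (twocatP M) h g f)).

Definition terminal_data : twocat_data :=
  @TwocatData unit (fun _ _ => unit) (fun _ _ _ _ => unit) (fun _ => tt)
    (fun _ _ _ _ _ => tt) (fun _ _ _ => tt) (fun _ _ _ _ _ _ _ => tt)
    (fun _ _ _ _ _ _ _ _ _ => tt).

Lemma terminal_laws : is_twocat terminal_data.
Proof.
  split; cbn; intros;
    repeat match goal with x : unit |- _ => destruct x end; reflexivity.
Qed.

Definition terminal : twocat := Twocat terminal_laws.

Definition prod_data (C D : twocat_data) : twocat_data :=
  @TwocatData (ob C * ob D)
    (fun p q => (hom (fst p) (fst q) * hom (snd p) (snd q))%type)
    (fun p q f g => (cell (fst f) (fst g) * cell (snd f) (snd g))%type)
    (fun p => (id1 (fst p), id1 (snd p)))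
    (fun p q r g f => (fst g o1 fst f, snd g o1 snd f))
    (fun p q f => (id2 (fst f), id2 (snd f)))
    (fun p q f g h b a => (fst b o2 fst a, snd b o2 snd a))
    (fun p q r g g' f f' b a => (fst b ** fst a, snd b ** snd a)).

Lemma pair_mor2 (C D : twocat_data)
    (A B A' B' : ob (prod_data C D)) (f g : hom A B) (f' g' : hom A' B')
    (a : cell f g) (b : cell f' g') :
  fst a =2= fst b -> snd a =2= snd b -> a =2= b.
Proof.
  destruct A, B, A', B', f, g, f', g', a, b; cbn; intros e1 e2.
  exact (f_equal2 (fun (p : mor2 C) (q : mor2 D) =>
    @Mor2 (prod_data C D) (_, _) (_, _) (_, _) (_, _) (mor2_cell p, mor2_cell q)) e1 e2).
Qed.

Lemma prod_laws (C D : twocat) : is_twocat (prod_data C D).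
Proof.
  destruct C as [C []], D as [D []].
  split; cbn; intros;
    repeat match goal with x : (_ * _)%type |- _ => destruct x; cbn in * end;
    try (f_equal; solve [auto]); apply pair_mor2; cbn; auto.
Qed.

Definition prod_twocat (C D : twocat) : twocat := Twocat (prod_laws C D).

Record pseudofunctor_data (C D : twocat_data) := PseudofunctorData {
  pf_ob :> ob C -> ob D;
  pf_hom : forall A B : ob C, hom A B -> hom (pf_ob A) (pf_ob B);
  pf_cell : forall (A B : ob C) (f g : hom A B), cell f g -> cell (pf_hom f) (pf_hom g);
  pf_comp : forall (A B E : ob C) (g : hom B E) (f : hom A B),
    cell (pf_hom g o1 pf_hom f) (pf_hom (g o1 f));
  pf_unit : forall A : ob C, cell (id1 (pf_ob A)) (pf_hom (id1 A)) }.

Arguments pf_hom {C D} F {A B} f : rename.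
Arguments pf_cell {C D} F {A B f g} a : rename.
Arguments pf_comp {C D} F {A B E} g f : rename.
Arguments pf_unit {C D} F A : rename.

Record is_pseudofunctor (C D : twocat_data) (F : pseudofunctor_data C D) : Prop :=
  IsPseudofunctor {
  pf_id2 : forall (A B : ob C) (f : hom A B), pf_cell F (id2 f) = id2 (pf_hom F f);
  pf_vcomp : forall (A B : ob C) (f g h : hom A B) (b : cell g h) (a : cell f g),
    pf_cell F (b o2 a) = pf_cell F b o2 pf_cell F a;
  pf_comp_iso : forall (A B E : ob C) (g : hom B E) (f : hom A B), is_iso2 (pf_comp F g f);
  pf_unit_iso : forall A : ob C, is_iso2 (pf_unit F A);
  pf_comp_natural : forall (A B E : ob C) (g g' : hom B E) (f f' : hom A B)
    (b : cell g g') (a : cell f f'),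
    pf_comp F g' f' o2 (pf_cell F b ** pf_cell F a) = pf_cell F (b ** a) o2 pf_comp F g f;
  pf_comp_assoc : forall (A B E G : ob C) (h : hom E G) (g : hom B E) (f : hom A B),
    pf_comp F (h o1 g) f o2 (pf_comp F h g ** id2 (pf_hom F f))
    =2= pf_comp F h (g o1 f) o2 (id2 (pf_hom F h) ** pf_comp F g f);
  pf_comp_unitr : forall (A B : ob C) (f : hom A B),
    pf_comp F f (id1 A) o2 (id2 (pf_hom F f) ** pf_unit F A) =2= id2 (pf_hom F f);
  pf_comp_unitl : forall (A B : ob C) (f : hom A B),
    pf_comp F (id1 B) f o2 (pf_unit F B ** id2 (pf_hom F f)) =2= id2 (pf_hom F f) }.

Record pseudofunctor (C D : twocat) := Pseudofunctor {
  pf_base :> pseudofunctor_data C D;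
  pfP : is_pseudofunctor pf_base }.

Lemma mor2_inj (M : twocat_data) (A B : ob M) (f g : hom A B) (a b : cell f g) :
  a =2= b -> a = b.
Proof.
  intros e.
  apply (f_equal (fun p : mor2 M =>
    existT (fun A => {B : ob M & {f : hom A B & {g : hom A B & cell f g}}}) _
      (existT (fun B => {f : hom (mor2_src0 p) B & {g : hom (mor2_src0 p) B & cell f g}}) _
        (existT (fun f => {g & cell f g}) _
          (existT (cell (mor2_src p)) _ (mor2_cell p)))))) in e; cbn in e.
  exact (inj_pair2 _ _ _ _ _ (inj_pair2 _ _ _ _ _
    (inj_pair2 _ _ _ _ _ (inj_pair2 _ _ _ _ _ e)))).
Qed.

Lemma mor2_vcomp (M : twocat_data) (A B A' B' : ob M) (f g h : hom A B)
    (f' g' h' : hom A' B') (b : cell g h) (a : cell f g)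
    (b' : cell g' h') (a' : cell f' g') :
  b =2= b' -> a =2= a' -> b o2 a =2= b' o2 a'.
Proof.
  intros eb ea; revert h h' b b' eb.
  change (forall h h' (b : cell (mor2_tgt (Mor2 a)) h) (b' : cell (mor2_tgt (Mor2 a')) h'),
    b =2= b' -> b o2 mor2_cell (Mor2 a) =2= b' o2 mor2_cell (Mor2 a')).
  destruct ea; cbn; intros h h' b b' eb.
  assert (e : h = h').
  { apply (f_equal (fun p : mor2 M => existT (fun A => {B : ob M & hom A B}) _
      (existT (fun B => hom (mor2_src0 p) B) _ (mor2_tgt p)))) in eb; cbn in eb.
    exact (inj_pair2 _ _ _ _ _ (inj_pair2 _ _ _ _ _ eb)). }
  subst h'; apply mor2_inj in eb; now subst b'.
Qed.

Lemma mor2_pf_cell (C D : twocat_data) (F : pseudofunctor_data C D)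
    (A B A' B' : ob C) (f g : hom A B) (f' g' : hom A' B')
    (a : cell f g) (a' : cell f' g') :
  a =2= a' -> pf_cell F a =2= pf_cell F a'.
Proof.
  intros e; exact (f_equal (fun p : mor2 C => Mor2 (pf_cell F (mor2_cell p))) e).
Qed.

Lemma is_iso2_vcomp (M : twocat) (A B : ob M) (f g h : hom A B)
    (b : cell g h) (a : cell f g) :
  is_iso2 b -> is_iso2 a -> is_iso2 (b o2 a).
Proof.
  intros [b' [b1 b2]] [a' [a1 a2]]; exists (a' o2 b').
  pose proof (twocatP M) as HM; split.
  - now rewrite (vcomp_assoc HM), <- (vcomp_assoc HM b' b a), b1, (vcomp_idl HM).
  - now rewrite (vcomp_assoc HM), <- (vcomp_assoc HM a a' b'), a2, (vcomp_idl HM).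
Qed.

Lemma is_iso2_id2 (M : twocat) (A B : ob M) (f : hom A B) : is_iso2 (id2 f).
Proof. exists (id2 f); split; apply (vcomp_idl (twocatP M)). Qed.

Lemma is_iso2_pf_cell (C D : twocat) (F : pseudofunctor C D) (A B : ob C) (f g : hom A B)
    (a : cell f g) :
  is_iso2 a -> is_iso2 (pf_cell F a).
Proof.
  intros [b [e1 e2]]; exists (pf_cell F b).
  now rewrite <- !(pf_vcomp (pfP F)), e1, e2, !(pf_id2 (pfP F)).
Qed.

Definition idpf_data (C : twocat_data) : pseudofunctor_data C C :=
  @PseudofunctorData C C (fun A => A) (fun A B f => f) (fun A B f g a => a)
    (fun A B E g f => id2 (g o1 f)) (fun A => id2 (id1 A)).

Definition fstpf_data (C D : twocat_data) : pseudofunctor_data (prod_data C D) C :=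
  @PseudofunctorData (prod_data C D) C (fun A => fst A) (fun A B f => fst f)
    (fun A B f g a => fst a)
    (fun A B E g f => id2 (fst g o1 fst f)) (fun A => id2 (id1 (fst A))).

Definition sndpf_data (C D : twocat_data) : pseudofunctor_data (prod_data C D) D :=
  @PseudofunctorData (prod_data C D) D (fun A => snd A) (fun A B f => snd f)
    (fun A B f g a => snd a)
    (fun A B E g f => id2 (snd g o1 snd f)) (fun A => id2 (id1 (snd A))).

Definition assocpf_data (C D E : twocat_data) :
    pseudofunctor_data (prod_data (prod_data C D) E) (prod_data C (prod_data D E)) :=
  @PseudofunctorData (prod_data (prod_data C D) E) (prod_data C (prod_data D E))
    (fun A => (fst (fst A), (snd (fst A), snd A)))
    (fun A B f => (fst (fst f), (snd (fst f), snd f)))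
    (fun A B f g a => (fst (fst a), (snd (fst a), snd a)))
    (fun A B G g f => (id2 (fst (fst g) o1 fst (fst f)),
      (id2 (snd (fst g) o1 snd (fst f)), id2 (snd g o1 snd f))))
    (fun A => (id2 (id1 (fst (fst A))), (id2 (id1 (snd (fst A))), id2 (id1 (snd A))))).

Lemma mor2_id2 (M : twocat_data) (A B : ob M) (f g : hom A B) :
  f = g -> id2 f =2= id2 g.
Proof. now intros []. Qed.

Lemma idpf_laws (C : twocat) : is_pseudofunctor (idpf_data C).
Proof.
  pose proof (twocatP C) as HC.
  split; cbn; intros; try apply is_iso2_id2;
    rewrite ?(hcomp_id2 HC), ?(vcomp_idl HC), ?(vcomp_idr HC); auto;
    apply mor2_id2; apply HC.
Qed.

Definition idpf (C : twocat) : pseudofunctor C C := Pseudofunctor (idpf_laws C).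

Lemma fstpf_laws (C D : twocat) : is_pseudofunctor (fstpf_data C D).
Proof.
  pose proof (twocatP C) as HC.
  split; cbn; intros; try apply is_iso2_id2;
    rewrite ?(hcomp_id2 HC), ?(vcomp_idl HC), ?(vcomp_idr HC); auto;
    apply mor2_id2; apply HC.
Qed.

Definition fstpf (C D : twocat) : pseudofunctor (prod_twocat C D) C :=
  @Pseudofunctor (prod_twocat C D) C _ (fstpf_laws C D).

Lemma sndpf_laws (C D : twocat) : is_pseudofunctor (sndpf_data C D).
Proof.
  pose proof (twocatP D) as HD.
  split; cbn; intros; try apply is_iso2_id2;
    rewrite ?(hcomp_id2 HD), ?(vcomp_idl HD), ?(vcomp_idr HD); auto;
    apply mor2_id2; apply HD.
Qed.

Definition sndpf (C D : twocat) : pseudofunctor (prod_twocat C D) D :=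
  @Pseudofunctor (prod_twocat C D) D _ (sndpf_laws C D).

Lemma is_iso2_pair (C D : twocat_data) (A B : ob (prod_data C D)) (f g : hom A B)
    (a : cell f g) :
  is_iso2 (fst a) -> is_iso2 (snd a) -> is_iso2 a.
Proof.
  destruct a as [a a']; cbn; intros [x [x1 x2]] [y [y1 y2]].
  exists (x, y); cbn; now rewrite x1, x2, y1, y2.
Qed.

Lemma assocpf_laws (C D E : twocat) : is_pseudofunctor (assocpf_data C D E).
Proof.
  pose proof (twocatP C) as HC; pose proof (twocatP D) as HD; pose proof (twocatP E) as HE.
  split; cbn; intros; rewrite ?(hcomp_id2 HC), ?(vcomp_idl HC), ?(vcomp_idr HC),
    ?(hcomp_id2 HD), ?(vcomp_idl HD), ?(vcomp_idr HD),
    ?(hcomp_id2 HE), ?(vcomp_idl HE), ?(vcomp_idr HE); auto;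
    repeat (apply is_iso2_pair || apply pair_mor2; cbn);
    try apply is_iso2_id2; apply mor2_id2; first [apply HC | apply HD | apply HE].
Qed.

Definition assocpf (C D E : twocat) :
    pseudofunctor (prod_twocat (prod_twocat C D) E) (prod_twocat C (prod_twocat D E)) :=
  @Pseudofunctor (prod_twocat (prod_twocat C D) E) (prod_twocat C (prod_twocat D E))
    _ (assocpf_laws C D E).

Definition prodpf_data (C D C' D' : twocat_data)
    (F : pseudofunctor_data C C') (G : pseudofunctor_data D D') :
    pseudofunctor_data (prod_data C D) (prod_data C' D') :=
  @PseudofunctorData (prod_data C D) (prod_data C' D')
    (fun A => (F (fst A), G (snd A)))
    (fun A B f => (pf_hom F (fst f), pf_hom G (snd f)))
    (fun A B f g a => (pf_cell F (fst a), pf_cell G (snd a)))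
    (fun A B E g f => (pf_comp F (fst g) (fst f), pf_comp G (snd g) (snd f)))
    (fun A => (pf_unit F (fst A), pf_unit G (snd A))).

Lemma prodpf_laws (C D C' D' : twocat) (F : pseudofunctor C C') (G : pseudofunctor D D') :
  is_pseudofunctor (prodpf_data F G).
Proof.
  pose proof (pfP F) as HF; pose proof (pfP G) as HG.
  split; cbn; intros; try (f_equal; first [apply HF | apply HG]);
    (apply is_iso2_pair || apply pair_mor2); cbn; first [apply HF | apply HG].
Qed.

Definition prodpf (C D C' D' : twocat) (F : pseudofunctor C C') (G : pseudofunctor D D') :
    pseudofunctor (prod_twocat C D) (prod_twocat C' D') :=
  @Pseudofunctor (prod_twocat C D) (prod_twocat C' D') _ (prodpf_laws F G).

Definition comppf_data (C D E : twocat_data)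
    (G : pseudofunctor_data D E) (F : pseudofunctor_data C D) : pseudofunctor_data C E :=
  @PseudofunctorData C E
    (fun A => G (F A))
    (fun A B f => pf_hom G (pf_hom F f))
    (fun A B f g a => pf_cell G (pf_cell F a))
    (fun A B H g f => pf_cell G (pf_comp F g f) o2 pf_comp G (pf_hom F g) (pf_hom F f))
    (fun A => pf_cell G (pf_unit F A) o2 pf_unit G (F A)).

Lemma comppf_laws (C D E : twocat) (G : pseudofunctor D E) (F : pseudofunctor C D) :
  is_pseudofunctor (comppf_data G F).
Proof.
  pose proof (pfP F) as HF; pose proof (pfP G) as HG; pose proof (twocatP E) as HE.
  assert (whisker_r : forall (A B H : ob E) (g g' g'' : hom B H) (f : hom A B)
      (b' : cell g' g'') (b : cell g g'),
      (b' o2 b) ** id2 f = (b' ** id2 f) o2 (b ** id2 f)).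
  { intros; now rewrite <- (hcomp_vcomp HE), (vcomp_idl HE). }
  assert (whisker_l : forall (A B H : ob E) (g : hom B H) (f f' f'' : hom A B)
      (a' : cell f' f'') (a : cell f f'),
      id2 g ** (a' o2 a) = (id2 g ** a') o2 (id2 g ** a)).
  { intros; now rewrite <- (hcomp_vcomp HE), (vcomp_idl HE). }
  assert (nat_r : forall (A B H : ob D) (g g' : hom B H) (f : hom A B) (b : cell g g')
      (k : hom (G A) (G H)) (x : cell k _),
      pf_comp G g' f o2 ((pf_cell G b ** id2 (pf_hom G f)) o2 x)
      = pf_cell G (b ** id2 f) o2 (pf_comp G g f o2 x)).
  { intros; now rewrite <- !(vcomp_assoc HE), <- (pf_comp_natural HG), (pf_id2 HG). }
  assert (nat_l : forall (A B H : ob D) (g : hom B H) (f f' : hom A B) (a : cell f f')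
      (k : hom (G A) (G H)) (x : cell k _),
      pf_comp G g f' o2 ((id2 (pf_hom G g) ** pf_cell G a) o2 x)
      = pf_cell G (id2 g ** a) o2 (pf_comp G g f o2 x)).
  { intros; now rewrite <- !(vcomp_assoc HE), <- (pf_comp_natural HG), (pf_id2 HG). }
  split; cbn.
  - intros; now rewrite (pf_id2 HF), (pf_id2 HG).
  - intros; now rewrite (pf_vcomp HF), (pf_vcomp HG).
  - intros; apply is_iso2_vcomp; [apply is_iso2_pf_cell; apply HF | apply HG].
  - intros; apply is_iso2_vcomp; [apply is_iso2_pf_cell; apply HF | apply HG].
  - intros.
    rewrite (vcomp_assoc HE), (pf_comp_natural HG), <- !(vcomp_assoc HE).
    now rewrite <- !(pf_vcomp HG), (pf_comp_natural HF).
  - intros.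
    rewrite whisker_r, whisker_l, !(vcomp_assoc HE), nat_r, nat_l.
    rewrite <- !(vcomp_assoc HE _ (pf_cell G _)), <- !(pf_vcomp HG).
    apply mor2_vcomp; [apply mor2_pf_cell; apply HF | apply HG].
  - intros.
    rewrite whisker_l, !(vcomp_assoc HE), nat_l.
    rewrite <- !(vcomp_assoc HE _ (pf_cell G _)), <- !(pf_vcomp HG).
    transitivity (Mor2 (id2 (pf_hom G (pf_hom F f)) o2 id2 (pf_hom G (pf_hom F f))));
      [|now rewrite (vcomp_idl HE)].
    apply mor2_vcomp; [|apply HG].
    rewrite <- (pf_id2 HG); apply mor2_pf_cell; apply HF.
  - intros.
    rewrite whisker_r, !(vcomp_assoc HE), nat_r.
    rewrite <- !(vcomp_assoc HE _ (pf_cell G _)), <- !(pf_vcomp HG).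
    transitivity (Mor2 (id2 (pf_hom G (pf_hom F f)) o2 id2 (pf_hom G (pf_hom F f))));
      [|now rewrite (vcomp_idl HE)].
    apply mor2_vcomp; [|apply HG].
    rewrite <- (pf_id2 HG); apply mor2_pf_cell; apply HF.
Qed.

Definition comppf (C D E : twocat) (G : pseudofunctor D E) (F : pseudofunctor C D) :
    pseudofunctor C E := Pseudofunctor (comppf_laws G F).

Record is_cubical (C C' D : twocat) (F : pseudofunctor (prod_twocat C C') D) : Prop :=
  IsCubical {
  cubical_l : forall (A B : ob C) (A' B' E' : ob C')
    (f : hom A B) (g : hom A' B') (g' : hom B' E'),
    is_id2 (pf_comp F (A := (A, A')) (B := (B, B')) (E := (B, E')) (id1 B, g') (f, g));
  cubical_r : forall (A B E : ob C) (A' B' : ob C')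
    (f : hom A B) (f' : hom B E) (g' : hom A' B'),
    is_id2 (pf_comp F (A := (A, A')) (B := (B, A')) (E := (E, B')) (f', g') (f, id1 A'));
  cubical_unit : forall (A : ob C) (A' : ob C'), is_id2 (pf_unit F (A, A')) }.

(** A monoid structure on [M] in the cartesian monoidal category of strict
    2-categories and pseudofunctors; the equations are equalities of
    pseudofunctors, coherence 2-isomorphisms included. *)
Record semistrict (M : twocat) := Semistrict {
  ss_unit : pseudofunctor terminal M;
  ss_tensor : pseudofunctor (prod_twocat M M) M;
  ss_assoc : comppf ss_tensor (prodpf ss_tensor (idpf M))
    = comppf (comppf ss_tensor (prodpf (idpf M) ss_tensor)) (assocpf M M M);
  ss_unitl : comppf ss_tensor (prodpf ss_unit (idpf M)) = sndpf terminal M;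
  ss_unitr : comppf ss_tensor (prodpf (idpf M) ss_unit) = fstpf M terminal;
  ss_cubical : is_cubical ss_tensor }.

(** Strict 2-functors extending [F0]; keeping the action on objects as a parameter
    makes the boundaries of the interchangors composable up to conversion. *)
Record strict_ext (C D : twocat) (F0 : ob C -> ob D) := StrictExt {
  sf_hom : forall A B : ob C, hom A B -> hom (F0 A) (F0 B);
  sf_cell : forall (A B : ob C) (f g : hom A B), cell f g -> cell (sf_hom f) (sf_hom g);
  sf_id1 : forall A : ob C, sf_hom (id1 A) = id1 (F0 A);
  sf_comp1 : forall (A B E : ob C) (g : hom B E) (f : hom A B),
    sf_hom (g o1 f) = sf_hom g o1 sf_hom f;
  sf_id2 : forall (A B : ob C) (f : hom A B), sf_cell (id2 f) = id2 (sf_hom f);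
  sf_vcomp : forall (A B : ob C) (f g h : hom A B) (b : cell g h) (a : cell f g),
    sf_cell (b o2 a) = sf_cell b o2 sf_cell a;
  sf_hcomp : forall (A B E : ob C) (g g' : hom B E) (f f' : hom A B)
    (b : cell g g') (a : cell f f'), sf_cell (b ** a) =2= sf_cell b ** sf_cell a }.

Arguments strict_ext C D F0 : clear implicits.
Arguments sf_hom {C D F0} F {A B} f : rename.
Arguments sf_cell {C D F0} F {A B f g} a : rename.

Record strict_functor (C D : twocat) := StrictFunctor {
  sf_ob : ob C -> ob D;
  sf_ext : strict_ext C D sf_ob }.

Arguments StrictFunctor {C D sf_ob} sf_ext.

Definition sf_id (C : twocat) : strict_functor C C.
Proof.
  refine (StrictFunctor (@StrictExt C C (fun A => A) (fun A B f => f)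
    (fun A B f g a => a) _ _ _ _ _)); reflexivity.
Defined.

Definition sf_comp (C D E : twocat) (G : strict_functor D E) (F : strict_functor C D) :
  strict_functor C E.
Proof.
  refine (StrictFunctor (@StrictExt C E (fun A => sf_ob G (sf_ob F A))
    (fun A B f => sf_hom (sf_ext G) (sf_hom (sf_ext F) f))
    (fun A B f g a => sf_cell (sf_ext G) (sf_cell (sf_ext F) a)) _ _ _ _ _)).
  - intros; now rewrite !sf_id1.
  - intros; now rewrite !sf_comp1.
  - intros; now rewrite !sf_id2.
  - intros; now rewrite !sf_vcomp.
  - intros; rewrite <- sf_hcomp.
    exact (f_equal (fun p : mor2 D => Mor2 (sf_cell (sf_ext G) (mor2_cell p)))
      (sf_hcomp (sf_ext F) b a)).
Defined.

Record stringent_data (M : twocat) := StringentData {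
  st_unit : ob M;
  st_ob : ob M -> ob M -> ob M;
  st_L : forall A : ob M, strict_ext M M (fun B => st_ob A B);
  st_R : forall B : ob M, strict_ext M M (fun A => st_ob A B);
  st_phi : forall (A A' B B' : ob M) (f : hom A A') (g : hom B B'),
    cell (sf_hom (st_R B') f o1 sf_hom (st_L A) g)
         (sf_hom (st_L A') g o1 sf_hom (st_R B) f) }.

Arguments st_phi {M} T {A A' B B'} f g : rename.

Definition Lf (M : twocat) (T : stringent_data M) (A : ob M) : strict_functor M M :=
  StrictFunctor (st_L T A).

Definition Rf (M : twocat) (T : stringent_data M) (B : ob M) : strict_functor M M :=
  StrictFunctor (st_R T B).

(** Nudging: tensor products of 1- and 2-morphisms are defined from [L] and [R]. *)
Definition st_hom (M : twocat) (T : stringent_data M) (A A' B B' : ob M)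
    (f : hom A A') (g : hom B B') : hom (st_ob T A B) (st_ob T A' B') :=
  sf_hom (st_L T A') g o1 sf_hom (st_R T B) f.

Definition st_cell (M : twocat) (T : stringent_data M) (A A' B B' : ob M)
    (f f' : hom A A') (g g' : hom B B') (a : cell f f') (b : cell g g') :
    cell (st_hom T f g) (st_hom T f' g') :=
  sf_cell (st_L T A') b ** sf_cell (st_R T B) a.

Record is_stringent (M : twocat) (T : stringent_data M) : Prop := IsStringent {
  st_assoc : forall A B C : ob M, st_ob T (st_ob T A B) C = st_ob T A (st_ob T B C);
  st_unitl : forall A : ob M, st_ob T (st_unit T) A = A;
  st_unitr : forall A : ob M, st_ob T A (st_unit T) = A;
  st_LL : forall A B : ob M, sf_comp (Lf T A) (Lf T B) = Lf T (st_ob T A B);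
  st_RR : forall A B : ob M, sf_comp (Rf T B) (Rf T A) = Rf T (st_ob T A B);
  st_LR : forall A B : ob M, sf_comp (Lf T A) (Rf T B) = sf_comp (Rf T B) (Lf T A);
  st_L1 : Lf T (st_unit T) = sf_id M;
  st_R1 : Rf T (st_unit T) = sf_id M;
  st_phi_iso : forall (A A' B B' : ob M) (f : hom A A') (g : hom B B'),
    is_iso2 (st_phi T f g);
  st_phi_L : forall (A B B' C C' : ob M) (g : hom B B') (h : hom C C'),
    st_phi T (sf_hom (st_L T A) g) h =2= sf_cell (st_L T A) (st_phi T g h);
  st_phi_M : forall (A A' B C C' : ob M) (f : hom A A') (h : hom C C'),
    st_phi T (sf_hom (st_R T B) f) h =2= st_phi T f (sf_hom (st_L T B) h);
  st_phi_R : forall (A A' B B' C : ob M) (f : hom A A') (g : hom B B'),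
    st_phi T f (sf_hom (st_R T C) g) =2= sf_cell (st_R T C) (st_phi T f g);
  st_phi_idr : forall (A A' B : ob M) (f : hom A A'), is_id2 (st_phi T f (id1 B));
  st_phi_idl : forall (A B B' : ob M) (g : hom B B'), is_id2 (st_phi T (id1 A) g);
  st_phi_natl : forall (A A' B B' : ob M) (f f' : hom A A') (a : cell f f') (g : hom B B'),
    st_phi T f' g o2 (sf_cell (st_R T B') a ** id2 (sf_hom (st_L T A) g))
    = (id2 (sf_hom (st_L T A') g) ** sf_cell (st_R T B) a) o2 st_phi T f g;
  st_phi_natr : forall (A A' B B' : ob M) (f : hom A A') (g g' : hom B B') (b : cell g g'),
    st_phi T f g' o2 (id2 (sf_hom (st_R T B') f) ** sf_cell (st_L T A) b)
    = (sf_cell (st_L T A') b ** id2 (sf_hom (st_R T B) f)) o2 st_phi T f g;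
  st_phi_compr : forall (A A' B B' B'' : ob M)
    (f : hom A A') (g : hom B B') (g' : hom B' B''),
    st_phi T f (g' o1 g)
    =2= (id2 (sf_hom (st_L T A') g') ** st_phi T f g)
        o2 assoc_cell (sf_hom (st_L T A') g') (sf_hom (st_R T B') f) (sf_hom (st_L T A) g)
        o2 (st_phi T f g' ** id2 (sf_hom (st_L T A) g));
  st_phi_compl : forall (A A' A'' B B' : ob M)
    (f : hom A A') (f' : hom A' A'') (g : hom B B'),
    st_phi T (f' o1 f) g
    =2= (st_phi T f' g ** id2 (sf_hom (st_R T B) f))
        o2 assoc_cell_inv (sf_hom (st_R T B') f') (sf_hom (st_L T A') g) (sf_hom (st_R T B) f)
        o2 (id2 (sf_hom (st_R T B') f') ** st_phi T f g) }.

Record stringent (M : twocat) := Stringent {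
  st_base :> stringent_data M;
  stP : is_stringent st_base }.

(** [T] has the unit object and the tensor product (of objects, 1-morphisms and
    2-morphisms) of [S], and its interchangors are the 2-isomorphisms
    [Phi_{(f, id), (id, g)}]. *)
Record restricts_to (M : twocat) (S : semistrict M) (T : stringent M) : Prop := RestrictsTo {
  res_unit : st_unit T = ss_unit S tt;
  res_ob : forall A B : ob M, st_ob T A B = ss_tensor S (A, B);
  res_L_hom : forall (A B B' : ob M) (g : hom B B'),
    sf_hom (st_L T A) g
    =1= pf_hom (ss_tensor S) (A := (A, B)) (B := (A, B')) (id1 A, g);
  res_L_cell : forall (A B B' : ob M) (g g' : hom B B') (b : cell g g'),
    sf_cell (st_L T A) b
    =2= pf_cell (ss_tensor S) (A := (A, B)) (B := (A, B'))
          (f := (id1 A, g)) (g := (id1 A, g')) (id2 (id1 A), b);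
  res_R_hom : forall (A A' B : ob M) (f : hom A A'),
    sf_hom (st_R T B) f
    =1= pf_hom (ss_tensor S) (A := (A, B)) (B := (A', B)) (f, id1 B);
  res_R_cell : forall (A A' B : ob M) (f f' : hom A A') (a : cell f f'),
    sf_cell (st_R T B) a
    =2= pf_cell (ss_tensor S) (A := (A, B)) (B := (A', B))
          (f := (f, id1 B)) (g := (f', id1 B)) (a, id2 (id1 B));
  res_hom : forall (A A' B B' : ob M) (f : hom A A') (g : hom B B'),
    st_hom T f g
    =1= pf_hom (ss_tensor S) (A := (A, B)) (B := (A', B')) (f, g);
  res_cell : forall (A A' B B' : ob M) (f f' : hom A A') (g g' : hom B B')
    (a : cell f f') (b : cell g g'),
    st_cell T a b
    =2= pf_cell (ss_tensor S) (A := (A, B)) (B := (A', B'))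
          (f := (f, g)) (g := (f', g')) (a, b);
  res_phi : forall (A A' B B' : ob M) (f : hom A A') (g : hom B B'),
    st_phi T f g
    =2= pf_comp (ss_tensor S) (A := (A, B)) (B := (A, B')) (E := (A', B'))
          (f, id1 B') (id1 A, g) }.

(* Main.v *)
From Stdlib Require Import Eqdep FunctionalExtensionality ProofIrrelevance ClassicalEpsilon.
Require Import Defs.

(** A cubical tensor product is determined by its interchangor: the associativity
    coherence, applied to [(f', g') = (id, g') o (f', id)] and [(f, g) = (id, g) o (f, id)],
    has all but one of its factors equal to identities, and leaves
    [Phi_{(f', g'), (f, g)} = (id (x) g') * phi_{f', g} * (f (x) id)]. Conversely this
    formula defines a cubical pseudofunctor; its associativity, and the equality of the
    two triple tensor products, reduce by the composition axioms for [phi] to the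
    interchange law for two interchangors acting on disjoint parts of a composite.
    Since restriction thus determines each structure from the other, the two
    constructions are mutually inverse. *)

Set Implicit Arguments.
Unset Strict Implicit.
Local Open Scope twocat_scope.

(** Associativity and unitality of objects and 1-morphisms are only propositional equations, so the
    two sides of many laws are 2-morphisms of different types, and transports along these equations
    would swamp the calculation. It is therefore done with 2-morphisms packed with their boundaries,
    under partial composites; the price is bookkeeping of definedness wherever interchange or
    functoriality is applied. Equality on the nose is recovered from packed equality by uniqueness
    of identity proofs, functional extensionality and proof irrelevance. A further obstacle is the
    unit: [ss_unit] is an arbitrary pseudofunctor out of the terminal 2-category, while a stringent
    structure retains only its object. Inverseness on the nose thus requires its 1-morphism and both
    of its coherences to be identities, which follows from the unit equations, cubicality and the
    pseudofunctor laws. *)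

Section Packed.

Variable M : twocat.
Let HM := twocatP M.

Lemma mor1_inj (A B : ob M) (f g : hom A B) : f =1= g -> f = g.
Proof.
  intros e.
  apply (f_equal (fun p : mor1 M => existT (fun A => {B : ob M & hom A B}) _
    (existT (fun B => hom (mor1_src p) B) _ (mor1_hom p)))) in e; cbn in e.
  exact (inj_pair2 _ _ _ _ _ (inj_pair2 _ _ _ _ _ e)).
Qed.

Lemma mor2_src_eq (A B A' B' : ob M) (f g : hom A B) (f' g' : hom A' B')
    (a : cell f g) (a' : cell f' g') : a =2= a' -> f =1= f'.
Proof. intros e; exact (f_equal (fun p : mor2 M => Mor1 (mor2_src p)) e). Qed.

Lemma mor2_tgt_eq (A B A' B' : ob M) (f g : hom A B) (f' g' : hom A' B')
    (a : cell f g) (a' : cell f' g') : a =2= a' -> g =1= g'.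
Proof. intros e; exact (f_equal (fun p : mor2 M => Mor1 (mor2_tgt p)) e). Qed.

Lemma mor2_hcomp (A B C A' B' C' : ob M) (g1 g2 : hom B C) (f1 f2 : hom A B)
    (g1' g2' : hom B' C') (f1' f2' : hom A' B')
    (b : cell g1 g2) (a : cell f1 f2) (b' : cell g1' g2') (a' : cell f1' f2') :
  b =2= b' -> a =2= a' -> b ** a =2= b' ** a'.
Proof.
  intros eb ea.
  pose proof (f_equal (@mor2_src0 M) eb); pose proof (f_equal (@mor2_tgt0 M) eb).
  pose proof (f_equal (@mor2_src0 M) ea); cbn in *; subst.
  pose proof (mor1_inj (mor2_src_eq eb)); pose proof (mor1_inj (mor2_tgt_eq eb)).
  pose proof (mor1_inj (mor2_src_eq ea)); pose proof (mor1_inj (mor2_tgt_eq ea)); subst.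
  apply mor2_inj in eb; apply mor2_inj in ea; now subst.
Qed.

Lemma mor2_eq_cell (A B : ob M) (f g : hom A B) (e : f = g) : eq_cell e =2= id2 f.
Proof. now destruct e. Qed.

Lemma is_iso2_eq_cell (A B : ob M) (f g : hom A B) (e : f = g) : is_iso2 (eq_cell e).
Proof. destruct e; apply is_iso2_id2. Qed.

Lemma is_iso2_hcomp (A B C : ob M) (g g' : hom B C) (f f' : hom A B)
    (b : cell g g') (a : cell f f') :
  is_iso2 b -> is_iso2 a -> is_iso2 (b ** a).
Proof.
  intros [b' [b1 b2]] [a' [a1 a2]]; exists (b' ** a').
  now rewrite <- !(hcomp_vcomp HM), b1, b2, a1, a2, !(hcomp_id2 HM).
Qed.

(** Packed 2-morphisms with an added undefined value [None]: composites whose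
    boundaries agree only propositionally can be written in [packed] without
    transports, and both composition laws become associative outright. *)
Local Notation packed := (option (mor2 M)).

Definition pk (A B : ob M) (f g : hom A B) (a : cell f g) : packed := Some (Mor2 a).

(** Composability asks for an equality of boundaries in arbitrary types, not decidable in general;
    excluded middle and choice turn a functional relation into a partial operation. *)
Definition lift2 (R : mor2 M -> mor2 M -> mor2 M -> Prop) (Y X : packed) : packed :=
  match Y, X with
  | Some y, Some x =>
    match excluded_middle_informative (exists z, R y x z) with
    | left e => Some (proj1_sig (constructive_indefinite_description _ e))
    | right _ => None
    end
  | _, _ => None
  end.

(** As an inductive relation, the graph expresses matching boundaries by shared indices, so no
    transport enters the definition. *)
Inductive vgraph : mor2 M -> mor2 M -> mor2 M -> Prop :=
  Vgraph (A B : ob M) (f g h : hom A B) (b : cell g h) (a : cell f g) :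
    vgraph (Mor2 b) (Mor2 a) (Mor2 (b o2 a)).

Inductive hgraph : mor2 M -> mor2 M -> mor2 M -> Prop :=
  Hgraph (A B C : ob M) (g g' : hom B C) (f f' : hom A B) (b : cell g g') (a : cell f f') :
    hgraph (Mor2 b) (Mor2 a) (Mor2 (b ** a)).

Definition vmul := lift2 vgraph.
Definition hmul := lift2 hgraph.

Arguments pk : simpl never.
Arguments vmul : simpl never.
Arguments hmul : simpl never.

Local Notation "<| a |>" := (pk a) (format "<| a |>").
Local Notation "Y *v X" := (vmul Y X) (at level 40, left associativity).
Local Notation "Y *h X" := (hmul Y X) (at level 39, left associativity).

Lemma packed_ext (X Y : packed) : (forall z, X = Some z <-> Y = Some z) -> X = Y.
Proof.
  intros H; destruct X as [x|].
  - symmetry; now apply H.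
  - destruct Y as [y|]; [apply H|]; reflexivity.
Qed.

(** One factor stays arbitrary and the other is retyped along its projections; what remains are
    equations of packed 2-morphisms instead of the dependent equalities of a direct inversion. *)
Lemma vgraph_inv (y x z : mor2 M) : vgraph y x z ->
  exists f (a : cell f (mor2_src y)), x = Mor2 a /\ z = Mor2 (mor2_cell y o2 a).
Proof. intros []; eauto. Qed.

Lemma vgraph_inv_r (y x z : mor2 M) : vgraph y x z ->
  exists h (b : cell (mor2_tgt x) h), y = Mor2 b /\ z = Mor2 (b o2 mor2_cell x).
Proof. intros []; eauto. Qed.

Lemma hgraph_inv (y x z : mor2 M) : hgraph y x z ->
  exists A (f f' : hom A (mor2_src0 y)) (a : cell f f'),
    x = Mor2 a /\ z = Mor2 (mor2_cell y ** a).
Proof. intros []; cbn; eauto 6. Qed.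

Lemma hgraph_inv_r (y x z : mor2 M) : hgraph y x z ->
  exists C (g g' : hom (mor2_tgt0 x) C) (b : cell g g'),
    y = Mor2 b /\ z = Mor2 (b ** mor2_cell x).
Proof. intros []; cbn; eauto 6. Qed.

Lemma vgraph_fun (y x z z' : mor2 M) : vgraph y x z -> vgraph y x z' -> z = z'.
Proof.
  intros H1%vgraph_inv H2%vgraph_inv.
  destruct H1 as (f & a & -> & ->), H2 as (f' & a' & e & ->).
  now apply mor2_vcomp.
Qed.

Lemma hgraph_fun (y x z z' : mor2 M) : hgraph y x z -> hgraph y x z' -> z = z'.
Proof.
  intros H1%hgraph_inv H2%hgraph_inv.
  destruct H1 as (A & f1 & f2 & a & -> & ->), H2 as (A' & f1' & f2' & a' & e & ->).
  now apply mor2_hcomp.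
Qed.

Lemma lift2_Some (R : mor2 M -> mor2 M -> mor2 M -> Prop) :
  (forall y x z z', R y x z -> R y x z' -> z = z') ->
  forall (Y X : packed) z,
    lift2 R Y X = Some z <-> exists y x, Y = Some y /\ X = Some x /\ R y x z.
Proof.
  intros Rfun Y X z; split.
  - destruct Y as [y|], X as [x|]; cbn; try discriminate.
    destruct excluded_middle_informative as [e|]; try discriminate.
    destruct constructive_indefinite_description as [w Hw]; cbn.
    intros [= ->]; eauto.
  - intros (y & x & -> & -> & H); cbn.
    destruct excluded_middle_informative as [e|n]; [|destruct n; eauto].
    destruct constructive_indefinite_description as [w Hw]; cbn.
    f_equal; eauto.
Qed.

Lemma vmul_Some (Y X : packed) z :
  Y *v X = Some z <-> exists y x, Y = Some y /\ X = Some x /\ vgraph y x z.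
Proof. exact (lift2_Some vgraph_fun Y X z). Qed.

Lemma hmul_Some (Y X : packed) z :
  Y *h X = Some z <-> exists y x, Y = Some y /\ X = Some x /\ hgraph y x z.
Proof. exact (lift2_Some hgraph_fun Y X z). Qed.

Lemma pk_vcomp (A B : ob M) (f g h : hom A B) (b : cell g h) (a : cell f g) :
  <|b o2 a|> = <|b|> *v <|a|>.
Proof. symmetry; apply vmul_Some; eexists _, _; repeat split. Qed.

Lemma pk_hcomp (A B C : ob M) (g g' : hom B C) (f f' : hom A B)
    (b : cell g g') (a : cell f f') :
  <|b ** a|> = <|b|> *h <|a|>.
Proof. symmetry; apply hmul_Some; eexists _, _; repeat split. Qed.

Lemma pk_inj (A B A' B' : ob M) (f g : hom A B) (f' g' : hom A' B')
    (a : cell f g) (a' : cell f' g') : <|a|> = <|a'|> -> a =2= a'.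
Proof.
  intros e; exact (f_equal (fun X => match X with Some x => x | None => Mor2 a end) e).
Qed.

Lemma pk_eq (A B A' B' : ob M) (f g : hom A B) (f' g' : hom A' B')
    (a : cell f g) (a' : cell f' g') : a =2= a' -> <|a|> = <|a'|>.
Proof. unfold pk; now intros ->. Qed.

Lemma pk_id2 (A B A' B' : ob M) (f : hom A B) (f' : hom A' B') :
  f =1= f' -> <|id2 f|> = <|id2 f'|>.
Proof. intros e; exact (f_equal (fun p : mor1 M => <|id2 (mor1_hom p)|>) e). Qed.

(** 1-morphisms enter the calculus through their identity 2-morphisms, so that their equations are
    proved by the same rewriting as equations of 2-morphisms. *)
Lemma pk_id2_inj (A B A' B' : ob M) (f : hom A B) (f' : hom A' B') :
  <|id2 f|> = <|id2 f'|> -> f =1= f'.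
Proof. intros e%pk_inj; exact (mor2_src_eq e). Qed.

Lemma pk_comp1 (A B C : ob M) (g : hom B C) (f : hom A B) :
  <|id2 (g o1 f)|> = <|id2 g|> *h <|id2 f|>.
Proof. now rewrite <- (hcomp_id2 HM), pk_hcomp. Qed.

Lemma pk_eq_cell (A B : ob M) (f g : hom A B) (e : f = g) : <|eq_cell e|> = <|id2 f|>.
Proof. now destruct e. Qed.

Lemma pk_eql (A B : ob M) (f g h : hom A B) (e : g = h) (a : cell f g) :
  <|eq_cell e o2 a|> = <|a|>.
Proof. destruct e; cbn; now rewrite (vcomp_idl HM). Qed.

Lemma pk_eqr (A B : ob M) (f g h : hom A B) (e : f = g) (a : cell g h) :
  <|a o2 eq_cell e|> = <|a|>.
Proof. destruct e; cbn; now rewrite (vcomp_idr HM). Qed.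

Lemma vmul_idl (A B : ob M) (f g : hom A B) (a : cell f g) : <|id2 g|> *v <|a|> = <|a|>.
Proof. now rewrite <- pk_vcomp, (vcomp_idl HM). Qed.

Lemma vmul_idr (A B : ob M) (f g : hom A B) (a : cell f g) : <|a|> *v <|id2 f|> = <|a|>.
Proof. now rewrite <- pk_vcomp, (vcomp_idr HM). Qed.

Lemma hmul_idl (A B : ob M) (f g : hom A B) (a : cell f g) :
  <|id2 (id1 B)|> *h <|a|> = <|a|>.
Proof. rewrite <- pk_hcomp; apply pk_eq, HM. Qed.

Lemma hmul_idr (A B : ob M) (f g : hom A B) (a : cell f g) :
  <|a|> *h <|id2 (id1 A)|> = <|a|>.
Proof. rewrite <- pk_hcomp; apply pk_eq, HM. Qed.

Lemma vmulA (Z Y X : packed) : Z *v Y *v X = Z *v (Y *v X).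
Proof.
  apply packed_ext; intros w; rewrite !vmul_Some; split.
  - intros (u & x & (z & y & -> & -> & [A B f g h c b])%vmul_Some & -> & H).
    apply vgraph_inv in H as (k & a & -> & ->); cbn in *.
    exists (Mor2 c), (Mor2 (b o2 a)); rewrite (vcomp_assoc HM), vmul_Some.
    repeat split; eexists _, _; repeat split.
  - intros (z & u & -> & (y & x & -> & -> & [A B f g h b a])%vmul_Some & H).
    apply vgraph_inv_r in H as (k & c & -> & ->); cbn in *.
    exists (Mor2 (c o2 b)), (Mor2 a); rewrite <- (vcomp_assoc HM), vmul_Some.
    repeat split; eexists _, _; repeat split.
Qed.

Lemma hmulA (Z Y X : packed) : Z *h Y *h X = Z *h (Y *h X).
Proof.
  apply packed_ext; intros w; rewrite !hmul_Some; split.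
  - intros (u & x & (z & y & -> & -> & [A B C h h' g g' c b])%hmul_Some & -> & H).
    apply hgraph_inv in H as (D & f & f' & a & -> & ->); cbn in *.
    exists (Mor2 c), (Mor2 (b ** a)); rewrite (hcomp_assoc HM), hmul_Some.
    repeat split; eexists _, _; repeat split.
  - intros (z & u & -> & (y & x & -> & -> & [A B C g g' f f' b a])%hmul_Some & H).
    apply hgraph_inv_r in H as (D & h & h' & c & -> & ->); cbn in *.
    exists (Mor2 (c ** b)), (Mor2 a); rewrite <- (hcomp_assoc HM), hmul_Some.
    repeat split; eexists _, _; repeat split.
Qed.

(** * Definedness, interchange and whiskering *)

Definition defined (X : packed) : Prop := X <> None.

Lemma defined_pk (A B : ob M) (f g : hom A B) (a : cell f g) : defined <|a|>.
Proof. discriminate. Qed.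

Lemma defined_eq (X : packed) (A B : ob M) (f g : hom A B) (a : cell f g) :
  <|a|> = X -> defined X.
Proof. now intros <-. Qed.

Lemma defined_vmul (Y X : packed) : defined (Y *v X) ->
  exists (A B : ob M) (f g h : hom A B) (b : cell g h) (a : cell f g),
    Y = <|b|> /\ X = <|a|>.
Proof.
  unfold defined; destruct (Y *v X) as [z|] eqn:e; [intros _|easy].
  apply vmul_Some in e as (y & x & -> & -> & [A B f g h b a]).
  now exists A, B, f, g, h, b, a.
Qed.

Lemma defined_hmul (Y X : packed) : defined (Y *h X) ->
  exists (A B C : ob M) (g g' : hom B C) (f f' : hom A B) (b : cell g g') (a : cell f f'),
    Y = <|b|> /\ X = <|a|>.
Proof.
  unfold defined; destruct (Y *h X) as [z|] eqn:e; [intros _|easy].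
  apply hmul_Some in e as (y & x & -> & -> & [A B C g g' f f' b a]).
  now exists A, B, C, g, g', f, f', b, a.
Qed.

Lemma hmul_None (A B B' C : ob M) (g g' : hom B' C) (f f' : hom A B)
    (b : cell g g') (a : cell f f') : B <> B' -> <|b|> *h <|a|> = None.
Proof.
  intros n; destruct (<|b|> *h <|a|>) as [z|] eqn:e; [|reflexivity].
  apply hmul_Some in e as (y & x & [= <-] & [= <-] & H).
  destruct n; change (mor2_tgt0 (Mor2 a) = mor2_src0 (Mor2 b)).
  now destruct H.
Qed.

Lemma hmul_None_r (X : packed) : X *h None = None.
Proof. now destruct X. Qed.

(** Definedness is a genuine condition: two composites [g' o1 f'] and [g o1 f] may coincide although
    their factors do not, and then only the right-hand side is defined. If the middle objects
    differ, both sides are [None]. *)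
Lemma interchange (Y' Y X' X : packed) :
  defined (Y' *v Y) -> defined (X' *v X) ->
  (Y' *v Y) *h (X' *v X) = (Y' *h X') *v (Y *h X).
Proof.
  intros (B & C & g & g' & g'' & b' & b & -> & ->)%defined_vmul.
  intros (A & B' & f & f' & f'' & a' & a & -> & ->)%defined_vmul.
  rewrite <- !pk_vcomp.
  destruct (excluded_middle_informative (B' = B)) as [e|n].
  - subst B'; now rewrite <- !pk_hcomp, <- pk_vcomp, (hcomp_vcomp HM).
  - now rewrite !hmul_None.
Qed.

(** A boundary-free substitute for being an identity 2-morphism. It is all that whiskering uses, and
    since it holds for [None] it passes to horizontal composites without a check that they are
    defined. *)
Definition idem (K : packed) : Prop := K *v K = K.

Lemma idem_id2 (A B : ob M) (f : hom A B) : idem <|id2 f|>.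
Proof. apply vmul_idl. Qed.

Lemma idem_hmul (K H : packed) : idem K -> idem H -> idem (K *h H).
Proof.
  unfold idem; intros eK eH.
  destruct K as [K|]; [|reflexivity].
  destruct H as [H|]; [|now rewrite hmul_None_r].
  rewrite <- interchange, eK, eH; congruence.
Qed.

Lemma whiskerl (K Y X : packed) : idem K -> defined (Y *v X) ->
  K *h (Y *v X) = (K *h Y) *v (K *h X).
Proof.
  intros eK D; destruct K as [K|]; [|reflexivity].
  rewrite <- interchange, eK; [reflexivity|rewrite eK; discriminate|exact D].
Qed.

Lemma whiskerr (Y X H : packed) : idem H -> defined (Y *v X) ->
  (Y *v X) *h H = (Y *h H) *v (X *h H).
Proof.
  intros eH D; destruct H as [H|]; [|now rewrite !hmul_None_r].
  rewrite <- interchange, eH; [reflexivity|exact D|rewrite eH; discriminate].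
Qed.

Lemma whisker (K Y X H : packed) : idem K -> idem H -> defined (Y *v X) ->
  K *h (Y *v X) *h H = (K *h Y *h H) *v (K *h X *h H).
Proof.
  intros eK eH D; rewrite !hmulA, whiskerr; trivial.
  destruct (excluded_middle_informative (defined (Y *h H *v (X *h H)))) as [D'|n].
  { now apply whiskerl. }
  destruct H as [[A0 B0 h h' c]|]; [change (Some _) with <|c|> in *|now rewrite !hmul_None_r].
  destruct (defined_vmul D) as (B & C & g & g' & g'' & b' & b & -> & ->).
  (* If the objects of [H] and [Y] match, whiskering keeps the vertical composite defined; otherwise
     every term containing [H] is [None]. *)
  destruct (excluded_middle_informative (B0 = B)) as [e|n'].
  - subst B0; destruct n; rewrite <- whiskerr, <- pk_vcomp, <- pk_hcomp; trivial.
    apply defined_pk.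
  - now rewrite !hmul_None, !hmul_None_r.
Qed.

(* Both composites are the horizontal composite of [b] and [a]. *)
Lemma slide (A B B' C : ob M) (g g' : hom B' C) (f f' : hom A B)
    (b : cell g g') (a : cell f f') :
  (<|id2 g'|> *h <|a|>) *v (<|b|> *h <|id2 f|>)
  = (<|b|> *h <|id2 f'|>) *v (<|id2 g|> *h <|a|>).
Proof.
  rewrite <- !interchange, !vmul_idl, !vmul_idr; try reflexivity;
    rewrite <- pk_vcomp; discriminate.
Qed.

(** The form in which two interchangors on disjoint letters of a word commute; [Phi_assoc] and
    [Phi_tensor] both reduce to it. If the middle objects differ, both sides are [None]. *)
Lemma slide_whisker (K H : packed) (A B B' C : ob M) (g g' : hom B' C) (f f' : hom A B)
    (b : cell g g') (a : cell f f') : idem K -> idem H ->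
  (K *h (<|id2 g'|> *h <|a|>) *h H) *v (K *h (<|b|> *h <|id2 f|>) *h H)
  = (K *h (<|b|> *h <|id2 f'|>) *h H) *v (K *h (<|id2 g|> *h <|a|>) *h H).
Proof.
  intros eK eH.
  destruct (excluded_middle_informative (B = B')) as [e|n].
  - subst B'.
    rewrite <- !whisker, slide; trivial; rewrite <- !pk_hcomp, <- pk_vcomp; apply defined_pk.
  - now rewrite !hmul_None, !hmul_None_r.
Qed.

End Packed.

Arguments pk : simpl never.
Arguments vmul : simpl never.
Arguments hmul : simpl never.

Local Notation "<| a |>" := (pk a) (format "<| a |>").
Local Notation "Y *v X" := (vmul Y X) (at level 40, left associativity).
Local Notation "Y *h X" := (hmul Y X) (at level 39, left associativity).

(** * Equality of structures from equality of packed components *)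

Lemma pseudofunctor_ext (C D : twocat) (F G : pseudofunctor C D) :
  (forall A, F A = G A) ->
  (forall (A B : ob C) (f : hom A B), pf_hom F f =1= pf_hom G f) ->
  (forall (A B : ob C) (f g : hom A B) (a : cell f g), pf_cell F a =2= pf_cell G a) ->
  (forall (A B E : ob C) (g : hom B E) (f : hom A B), pf_comp F g f =2= pf_comp G g f) ->
  (forall A, pf_unit F A =2= pf_unit G A) ->
  F = G.
Proof.
  destruct F as [[o h c p u] HF], G as [[o' h' c' p' u'] HG]; cbn; intros e0 e1 e2 ep eu.
  apply functional_extensionality in e0; subst o'.
  assert (h = h') as <-.
  { do 3 (apply functional_extensionality_dep; intro); apply mor1_inj, e1. }
  assert (c = c') as <-.
  { do 5 (apply functional_extensionality_dep; intro); apply mor2_inj, e2. }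
  assert (p = p') as <-.
  { do 5 (apply functional_extensionality_dep; intro); apply mor2_inj, ep. }
  assert (u = u') as <-.
  { apply functional_extensionality_dep; intro; apply mor2_inj, eu. }
  now rewrite (proof_irrelevance _ HF HG).
Qed.

Lemma strict_ext_eq (C D : twocat) (F0 : ob C -> ob D) (F G : strict_ext C D F0) :
  (forall (A B : ob C) (f : hom A B), sf_hom F f =1= sf_hom G f) ->
  (forall (A B : ob C) (f g : hom A B) (a : cell f g), sf_cell F a =2= sf_cell G a) ->
  F = G.
Proof.
  destruct F as [h c p1 p2 p3 p4 p5], G as [h' c' q1 q2 q3 q4 q5]; cbn; intros e1 e2.
  assert (h = h') as <-.
  { do 3 (apply functional_extensionality_dep; intro); apply mor1_inj, e1. }
  assert (c = c') as <-.
  { do 5 (apply functional_extensionality_dep; intro); apply mor2_inj, e2. }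
  f_equal; apply proof_irrelevance.
Qed.

Lemma strict_functor_ext (C D : twocat) (F G : strict_functor C D) :
  (forall A, sf_ob F A = sf_ob G A) ->
  (forall (A B : ob C) (f : hom A B), sf_hom (sf_ext F) f =1= sf_hom (sf_ext G) f) ->
  (forall (A B : ob C) (f g : hom A B) (a : cell f g),
     sf_cell (sf_ext F) a =2= sf_cell (sf_ext G) a) ->
  F = G.
Proof.
  destruct F as [o F], G as [o' G]; cbn; intros e0 e1 e2.
  apply functional_extensionality in e0; subst o'.
  f_equal; now apply strict_ext_eq.
Qed.

Lemma stringent_ext (M : twocat) (T T' : stringent M) :
  st_unit T = st_unit T' ->
  (forall A B, st_ob T A B = st_ob T' A B) ->
  (forall (A B B' : ob M) (g : hom B B'),
     sf_hom (st_L T A) g =1= sf_hom (st_L T' A) g) ->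
  (forall (A B B' : ob M) (g g' : hom B B') (b : cell g g'),
     sf_cell (st_L T A) b =2= sf_cell (st_L T' A) b) ->
  (forall (A A' B : ob M) (f : hom A A'),
     sf_hom (st_R T B) f =1= sf_hom (st_R T' B) f) ->
  (forall (A A' B : ob M) (f f' : hom A A') (a : cell f f'),
     sf_cell (st_R T B) a =2= sf_cell (st_R T' B) a) ->
  (forall (A A' B B' : ob M) (f : hom A A') (g : hom B B'),
     st_phi T f g =2= st_phi T' f g) ->
  T = T'.
Proof.
  destruct T as [[u o L R p] HT], T' as [[u' o' L' R' p'] HT']; cbn.
  intros eu eo L1 L2 R1 R2 ep; subst u'.
  assert (o = o') as <-.
  { do 2 (apply functional_extensionality; intro); apply eo. }
  assert (L = L') as <-.
  { apply functional_extensionality_dep; intro A; apply strict_ext_eq; auto. }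
  assert (R = R') as <-.
  { apply functional_extensionality_dep; intro B; apply strict_ext_eq; auto. }
  assert (p = p') as <-.
  { do 6 (apply functional_extensionality_dep; intro); apply mor2_inj, ep. }
  now rewrite (proof_irrelevance _ HT HT').
Qed.

Lemma semistrict_ext (M : twocat) (S S' : semistrict M) :
  ss_unit S = ss_unit S' -> ss_tensor S = ss_tensor S' -> S = S'.
Proof.
  destruct S, S'; cbn; intros <- <-; f_equal; apply proof_irrelevance.
Qed.

(** On packed 2-morphisms the equations between composites of the functors [L] and [R] become
    equations of plain functions, with no transport between target objects. *)
Definition fmap (C D : twocat) (F0 : ob C -> ob D) (F : strict_ext C D F0)
    (X : option (mor2 C)) : option (mor2 D) :=
  match X with Some x => <|sf_cell F (mor2_cell x)|> | None => None end.

Arguments fmap : simpl never.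

Section Fmap.

Variables (C D : twocat) (F0 : ob C -> ob D) (F : strict_ext C D F0).

Lemma pk_sf_cell (A B : ob C) (f g : hom A B) (a : cell f g) :
  <|sf_cell F a|> = fmap F <|a|>.
Proof. reflexivity. Qed.

Lemma pk_sf_hom (A B : ob C) (f : hom A B) : <|id2 (sf_hom F f)|> = fmap F <|id2 f|>.
Proof. now rewrite <- pk_sf_cell, sf_id2. Qed.

(** The condition is a real one: [F] may identify 1-morphisms and so make images composable when the
    arguments are not. *)
Lemma fmap_vmul (Y X : option (mor2 C)) :
  defined (Y *v X) -> fmap F (Y *v X) = fmap F Y *v fmap F X.
Proof.
  intros (A & B & f & g & h & b & a & -> & ->)%defined_vmul.
  now rewrite <- pk_vcomp, <- !pk_sf_cell, <- pk_vcomp, sf_vcomp.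
Qed.

Lemma fmap_hmul (Y X : option (mor2 C)) :
  defined (Y *h X) -> fmap F (Y *h X) = fmap F Y *h fmap F X.
Proof.
  intros (A & B & E & g & g' & f & f' & b & a & -> & ->)%defined_hmul.
  rewrite <- pk_hcomp, <- !pk_sf_cell, <- pk_hcomp; apply pk_eq, sf_hcomp.
Qed.

Lemma fmap_pk_hmul (A B E : ob C) (g g' : hom B E) (f f' : hom A B)
    (b : cell g g') (a : cell f f') :
  fmap F (<|b|> *h <|a|>) = fmap F <|b|> *h fmap F <|a|>.
Proof. apply fmap_hmul; rewrite <- pk_hcomp; apply defined_pk. Qed.

Lemma idem_fmap (K : option (mor2 C)) : idem K -> idem (fmap F K).
Proof.
  intros e; destruct K as [K|]; [|reflexivity].
  red; rewrite <- fmap_vmul; rewrite e; [reflexivity|discriminate].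
Qed.

End Fmap.

(** * From interchangors to a cubical tensor product *)

Section Extension.

Variables (M : twocat) (T : stringent M).
Let HM := twocatP M.
Let HT := stP T.

Local Notation L A := (st_L T A).
Local Notation R A := (st_R T A).
Local Notation phi f g := (st_phi T f g).

Lemma fmap_LL (A B : ob M) X : fmap (L A) (fmap (L B) X) = fmap (L (st_ob T A B)) X.
Proof.
  destruct X as [x|]; [|reflexivity].
  apply pk_eq.
  exact (f_equal (fun F => Mor2 (sf_cell (sf_ext F) (mor2_cell x))) (st_LL HT A B)).
Qed.

Lemma fmap_RR (A B : ob M) X : fmap (R B) (fmap (R A) X) = fmap (R (st_ob T A B)) X.
Proof.
  destruct X as [x|]; [|reflexivity].
  apply pk_eq.
  exact (f_equal (fun F => Mor2 (sf_cell (sf_ext F) (mor2_cell x))) (st_RR HT A B)).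
Qed.

Lemma fmap_LR (A B : ob M) X : fmap (L A) (fmap (R B) X) = fmap (R B) (fmap (L A) X).
Proof.
  destruct X as [x|]; [|reflexivity].
  apply pk_eq.
  exact (f_equal (fun F => Mor2 (sf_cell (sf_ext F) (mor2_cell x))) (st_LR HT A B)).
Qed.

Lemma fmap_L1 X : fmap (L (st_unit T)) X = X.
Proof.
  destruct X as [[]|]; [|reflexivity].
  apply pk_eq.
  exact (f_equal (fun F => Mor2 (sf_cell (sf_ext F) _)) (st_L1 HT)).
Qed.

Lemma fmap_R1 X : fmap (R (st_unit T)) X = X.
Proof.
  destruct X as [[]|]; [|reflexivity].
  apply pk_eq.
  exact (f_equal (fun F => Mor2 (sf_cell (sf_ext F) _)) (st_R1 HT)).
Qed.

Lemma pk_L (A B B' : ob M) (g : hom B B') :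
  <|id2 (sf_hom (L A) g)|> = fmap (L A) <|id2 g|>.
Proof. apply pk_sf_hom. Qed.

Lemma pk_R (A A' B : ob M) (f : hom A A') :
  <|id2 (sf_hom (R B) f)|> = fmap (R B) <|id2 f|>.
Proof. apply (pk_sf_hom (R B)). Qed.

Lemma pk_st_hom (A A' B B' : ob M) (f : hom A A') (g : hom B B') :
  <|id2 (st_hom T f g)|> = fmap (L A') <|id2 g|> *h fmap (R B) <|id2 f|>.
Proof. unfold st_hom; now rewrite pk_comp1, pk_L, pk_R. Qed.

Lemma pk_st_cell (A A' B B' : ob M) (f f' : hom A A') (g g' : hom B B')
    (a : cell f f') (b : cell g g') :
  <|st_cell T a b|> = fmap (L A') <|b|> *h fmap (R B) <|a|>.
Proof. exact (pk_hcomp _ _). Qed.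

Lemma st_cell_id2 (A A' B B' : ob M) (f : hom A A') (g : hom B B') :
  st_cell T (id2 f) (id2 g) = id2 (st_hom T f g).
Proof. unfold st_cell, st_hom; now rewrite (sf_id2 (L A')), (sf_id2 (R B)), (hcomp_id2 HM). Qed.

Lemma st_cell_vcomp (A A' B B' : ob M) (f f' f'' : hom A A') (g g' g'' : hom B B')
    (a' : cell f' f'') (a : cell f f') (b' : cell g' g'') (b : cell g g') :
  st_cell T (a' o2 a) (b' o2 b) = st_cell T a' b' o2 st_cell T a b.
Proof. unfold st_cell; now rewrite (sf_vcomp (L A')), (sf_vcomp (R B)), (hcomp_vcomp HM). Qed.

Lemma st_hom_id1 (A B : ob M) : id1 (st_ob T A B) = st_hom T (id1 A) (id1 B).
Proof. unfold st_hom; now rewrite (sf_id1 (L A)), (sf_id1 (R B)), (comp1_idl HM). Qed.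

Section Comp.

Variables (A A' A'' B B' B'' : ob M).
Variables (f' : hom A' A'') (g' : hom B' B'') (f : hom A A') (g : hom B B').

Lemma Phi_src : st_hom T f' g' o1 st_hom T f g =
  sf_hom (L A'') g' o1 (sf_hom (R B') f' o1 sf_hom (L A') g) o1 sf_hom (R B) f.
Proof. unfold st_hom; now rewrite !(comp1_assoc HM). Qed.

Lemma Phi_tgt :
  sf_hom (L A'') g' o1 (sf_hom (L A'') g o1 sf_hom (R B) f') o1 sf_hom (R B) f =
  st_hom T (f' o1 f) (g' o1 g).
Proof.
  unfold st_hom; rewrite (sf_comp1 (L A'')), (sf_comp1 (R B)).
  now rewrite !(comp1_assoc HM).
Qed.

(* The source is the word [g' f' g f]; only [f'] and [g] have to be exchanged. *)
Definition Phi : cell (st_hom T f' g' o1 st_hom T f g) (st_hom T (f' o1 f) (g' o1 g)) :=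
  eq_cell Phi_tgt
  o2 (id2 (sf_hom (L A'') g') ** phi f' g ** id2 (sf_hom (R B) f))
  o2 eq_cell Phi_src.

Lemma pk_Phi : <|Phi|> = fmap (L A'') <|id2 g'|> *h <|phi f' g|> *h fmap (R B) <|id2 f|>.
Proof. unfold Phi; now rewrite pk_eqr, pk_eql, !pk_hcomp, pk_L, pk_R. Qed.

Lemma is_iso2_Phi : is_iso2 Phi.
Proof.
  repeat apply is_iso2_vcomp; try apply is_iso2_eq_cell.
  repeat apply is_iso2_hcomp; try apply is_iso2_id2; apply HT.
Qed.

End Comp.

Lemma Phi_natural (A A' A'' B B' B'' : ob M)
    (f1' f2' : hom A' A'') (g1' g2' : hom B' B'') (f1 f2 : hom A A') (g1 g2 : hom B B')
    (a' : cell f1' f2') (b' : cell g1' g2') (a : cell f1 f2) (b : cell g1 g2) :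
  Phi f2' g2' f2 g2 o2 (st_cell T a' b' ** st_cell T a b)
  = st_cell T (a' ** a) (b' ** b) o2 Phi f1' g1' f1 g1.
Proof.
  (* The cell [a' ** b] is split as [(a' ** id) o2 (id ** b)], so that naturality of [phi] applies
     in one variable at a time. *)
  assert (nat : phi f2' g2 o2 (sf_cell (R B') a' ** sf_cell (L A') b)
    = (sf_cell (L A'') b ** sf_cell (R B) a') o2 phi f1' g1).
  { transitivity (phi f2' g2 o2 ((sf_cell (R B') a' o2 id2 _) ** (id2 _ o2 sf_cell (L A') b))).
    { now rewrite (vcomp_idl HM), (vcomp_idr HM). }
    rewrite (hcomp_vcomp HM), <- (vcomp_assoc HM), (st_phi_natl HT), (vcomp_assoc HM).
    rewrite (st_phi_natr HT), <- (vcomp_assoc HM), <- (hcomp_vcomp HM).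
    now rewrite (vcomp_idl HM), (vcomp_idr HM). }
  (* [X] is the core of [Phi] without its two [eq_cell]s. Naturality is proved in this bracketing,
     where the types match, and packing carries it over to the bracketing of
     [st_cell T a' b' ** st_cell T a b]. *)
  pose (X (i : hom B' B'') (j : hom A' A'') (k : hom B B') (l : hom A A') :=
    id2 (sf_hom (L A'') i) ** phi j k ** id2 (sf_hom (R B) l)).
  assert (eq : X g2' f2' g2 f2
      o2 (sf_cell (L A'') b' ** (sf_cell (R B') a' ** sf_cell (L A') b) ** sf_cell (R B) a)
    = (sf_cell (L A'') b' ** (sf_cell (L A'') b ** sf_cell (R B) a') ** sf_cell (R B) a)
      o2 X g1' f1' g1 f1).
  { unfold X; now rewrite <- !(hcomp_vcomp HM), nat, !(vcomp_idl HM), !(vcomp_idr HM). }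
  apply mor2_inj, pk_inj; apply (f_equal (fun c => <|c|>)) in eq; unfold X in eq.
  rewrite !pk_vcomp, !pk_hcomp, !pk_L, !pk_R in eq.
  rewrite !pk_vcomp, !pk_Phi, !pk_hcomp, !pk_st_cell, !pk_hcomp.
  rewrite !fmap_pk_hmul, !hmulA.
  rewrite !hmulA in eq; exact eq.
Qed.

Lemma pk_phi_compl (A A' A'' B B' : ob M)
    (f : hom A A') (f' : hom A' A'') (g : hom B B') :
  <|phi (f' o1 f) g|> = (<|phi f' g|> *h fmap (R B) <|id2 f|>)
    *v (fmap (R B') <|id2 f'|> *h <|phi f g|>).
Proof.
  rewrite (pk_eq (st_phi_compl HT f f' g)); unfold assoc_cell_inv.
  now rewrite pk_vcomp, pk_eqr, !pk_hcomp, !pk_R.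
Qed.

Lemma pk_phi_compr (A A' B B' B'' : ob M)
    (f : hom A A') (g : hom B B') (g' : hom B' B'') :
  <|phi f (g' o1 g)|> = (fmap (L A') <|id2 g'|> *h <|phi f g|>)
    *v (<|phi f g'|> *h fmap (L A) <|id2 g|>).
Proof.
  rewrite (pk_eq (st_phi_compr HT f g g')); unfold assoc_cell.
  now rewrite pk_vcomp, pk_eqr, !pk_hcomp, !pk_L.
Qed.

Lemma pk_phi_L (A B B' C C' : ob M) (g : hom B B') (h : hom C C') :
  <|phi (sf_hom (L A) g) h|> = fmap (L A) <|phi g h|>.
Proof. apply pk_eq, HT. Qed.

Lemma pk_phi_R (A A' B B' C : ob M) (f : hom A A') (g : hom B B') :
  <|phi f (sf_hom (R C) g)|> = fmap (R C) <|phi f g|>.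
Proof. apply pk_eq, HT. Qed.

Lemma pk_phi_M (A A' B C C' : ob M) (f : hom A A') (h : hom C C') :
  <|phi (sf_hom (R B) f) h|> = <|phi f (sf_hom (L B) h)|>.
Proof. apply pk_eq, HT. Qed.

Ltac idem := repeat (apply idem_hmul || apply idem_fmap || apply idem_id2).

(** In the word [h2 h1 g2 g1 f2 f1], both sides exchange [h1] with [g2] and [g1] with [f2], in
    opposite orders, and finish by moving [h1] past [f2]. The first two exchanges touch disjoint
    letters. *)
Lemma Phi_assoc (A0 A1 A2 A3 B0 B1 B2 B3 : ob M)
    (h1 : hom A2 A3) (h2 : hom B2 B3) (g1 : hom A1 A2) (g2 : hom B1 B2)
    (f1 : hom A0 A1) (f2 : hom B0 B1) :
  Phi (h1 o1 g1) (h2 o1 g2) f1 f2 o2 (Phi h1 h2 g1 g2 ** id2 (st_hom T f1 f2))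
  =2= Phi h1 h2 (g1 o1 f1) (g2 o1 f2) o2 (id2 (st_hom T h1 h2) ** Phi g1 g2 f1 f2).
Proof.
  apply pk_inj.
  rewrite !pk_vcomp, !pk_hcomp, !pk_Phi, !pk_st_hom, !pk_comp1, !fmap_pk_hmul.
  rewrite pk_phi_compl, whisker; [|idem|idem|rewrite <- pk_phi_compl; apply defined_pk].
  rewrite pk_phi_compr, whisker; [|idem|idem|rewrite <- pk_phi_compr; apply defined_pk].
  assert (e := slide_whisker (phi h1 g2) (phi g1 f2)
    (idem_fmap (L A3) (idem_id2 h2)) (idem_fmap (R B0) (idem_id2 f1))).
  rewrite !pk_comp1, !pk_L, !pk_R in e.
  rewrite !vmulA, !hmulA in *; now f_equal.
Qed.

Definition tensor_data : pseudofunctor_data (prod_data M M) M :=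
  @PseudofunctorData (prod_data M M) M
    (fun A => st_ob T (fst A) (snd A))
    (fun A B f => st_hom T (fst f) (snd f))
    (fun A B f g a => st_cell T (fst a) (snd a))
    (fun A B E g f => Phi (fst g) (snd g) (fst f) (snd f))
    (fun A => eq_cell (st_hom_id1 (fst A) (snd A))).

Lemma pk_phi_idr (A A' B : ob M) (f : hom A A') : <|phi f (id1 B)|> = fmap (R B) <|id2 f|>.
Proof.
  rewrite (pk_eq (st_phi_idr HT B f)), pk_comp1, pk_L, pk_R.
  rewrite <- (pk_L A (id1 B)), (sf_id1 (L A)), <- pk_R, hmul_idr; reflexivity.
Qed.

Lemma pk_phi_idl (A B B' : ob M) (g : hom B B') : <|phi (id1 A) g|> = fmap (L A) <|id2 g|>.
Proof.
  rewrite (pk_eq (st_phi_idl HT A g)), pk_comp1, pk_L, pk_R.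
  rewrite <- (pk_R B' (id1 A)), (sf_id1 (R B')), <- pk_L, hmul_idl; reflexivity.
Qed.

Lemma fmap_L_id1 (A B : ob M) : fmap (L A) <|id2 (id1 B)|> = <|id2 (id1 (st_ob T A B))|>.
Proof. now rewrite <- pk_L, (sf_id1 (L A)). Qed.

Lemma fmap_R_id1 (A B : ob M) : fmap (R B) <|id2 (id1 A)|> = <|id2 (id1 (st_ob T A B))|>.
Proof. now rewrite <- pk_R, (sf_id1 (R B)). Qed.

Lemma Phi_id_l (A A' B B' B'' : ob M) (f : hom A A') (g : hom B B') (g' : hom B' B'') :
  is_id2 (Phi (id1 A') g' f g).
Proof.
  apply pk_inj; rewrite pk_Phi, pk_phi_idl, pk_comp1, !pk_st_hom, fmap_R_id1.
  now rewrite <- !pk_L, hmul_idr, !hmulA.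
Qed.

Lemma Phi_id_r (A A' A'' B B' : ob M) (f : hom A A') (f' : hom A' A'') (g' : hom B B') :
  is_id2 (Phi f' g' f (id1 B)).
Proof.
  apply pk_inj; rewrite pk_Phi, pk_phi_idr, pk_comp1, !pk_st_hom, fmap_L_id1.
  rewrite <- !(pk_R B f), hmul_idl; now rewrite !hmulA.
Qed.

Lemma tensor_laws : is_pseudofunctor tensor_data.
Proof.
  split; cbn; intros.
  - apply st_cell_id2.
  - apply st_cell_vcomp.
  - apply is_iso2_Phi.
  - apply is_iso2_eq_cell.
  - apply Phi_natural.
  - apply Phi_assoc.
  - apply pk_inj; rewrite pk_vcomp, pk_hcomp, pk_eq_cell, hmul_idr.
    rewrite (pk_eq (Phi_id_r _ _ _)), <- st_hom_id1, (comp1_idr HM); apply vmul_idl.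
  - apply pk_inj; rewrite pk_vcomp, pk_hcomp, pk_eq_cell, hmul_idl.
    rewrite (pk_eq (Phi_id_l _ _ _)), <- st_hom_id1, (comp1_idl HM); apply vmul_idl.
Qed.

Definition tensor : pseudofunctor (prod_twocat M M) M :=
  @Pseudofunctor (prod_twocat M M) M _ tensor_laws.

Definition unit_data : pseudofunctor_data terminal M :=
  @PseudofunctorData terminal M (fun _ => st_unit T) (fun _ _ _ => id1 _)
    (fun _ _ _ _ _ => id2 _) (fun _ _ _ _ _ => eq_cell (comp1_idl HM (id1 _)))
    (fun _ => id2 _).

Lemma unit_laws : is_pseudofunctor unit_data.
Proof.
  split; cbn; intros.
  - reflexivity.
  - now rewrite (vcomp_idl HM).
  - apply is_iso2_eq_cell.
  - apply is_iso2_id2.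
  - now rewrite (hcomp_id2 HM), (vcomp_idl HM), (vcomp_idr HM).
  - apply pk_inj; rewrite !pk_eql, !pk_hcomp, !pk_eq_cell, !pk_comp1; apply hmulA.
  - apply pk_inj; rewrite !pk_eql, !pk_hcomp; apply hmul_idl.
  - apply pk_inj; rewrite !pk_eql, !pk_hcomp; apply hmul_idl.
Qed.

Definition unit : pseudofunctor terminal M := Pseudofunctor unit_laws.

Lemma fmap_st_hom (F0 : ob M -> ob M) (F : strict_ext M M F0)
    (A A' B B' : ob M) (f : hom A A') (g : hom B B') :
  fmap F <|id2 (st_hom T f g)|>
  = fmap F (fmap (L A') <|id2 g|>) *h fmap F (fmap (R B) <|id2 f|>).
Proof. rewrite pk_st_hom; apply fmap_hmul; eapply defined_eq, pk_st_hom. Qed.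

Lemma fmap_st_cell (F0 : ob M -> ob M) (F : strict_ext M M F0)
    (A A' B B' : ob M) (f f' : hom A A') (g g' : hom B B')
    (a : cell f f') (b : cell g g') :
  fmap F <|st_cell T a b|> = fmap F (fmap (L A') <|b|>) *h fmap F (fmap (R B) <|a|>).
Proof. rewrite pk_st_cell; apply fmap_hmul; eapply defined_eq, pk_st_cell. Qed.

Lemma fmap_Phi (F0 : ob M -> ob M) (F : strict_ext M M F0) (A A' A'' B B' B'' : ob M)
    (f' : hom A' A'') (g' : hom B' B'') (f : hom A A') (g : hom B B') :
  fmap F <|Phi f' g' f g|> = fmap F (fmap (L A'') <|id2 g'|>) *h fmap F <|phi f' g|>
    *h fmap F (fmap (R B) <|id2 f|>).
Proof.
  rewrite pk_Phi, !fmap_hmul;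
    trivial; rewrite <- pk_L, <- ?pk_R, <- !pk_hcomp; apply defined_pk.
Qed.

(** By nudging, [st_hom T f g] is a composite of a left and a right tensoring: the composition axiom
    splits its interchangor, and [st_phi_L] and [st_phi_M] rewrite the factors. *)
Lemma pk_phi_st_homl (A A' B B' C C' : ob M) (f : hom A A') (g : hom B B') (h : hom C C') :
  <|phi (st_hom T f g) h|>
  = (fmap (L A') <|phi g h|> *h fmap (R C) (fmap (R B) <|id2 f|>))
    *v (fmap (R C') (fmap (L A') <|id2 g|>) *h <|phi f (sf_hom (L B) h)|>).
Proof. unfold st_hom; now rewrite pk_phi_compl, pk_phi_L, pk_phi_M, pk_L, pk_R. Qed.

Lemma pk_phi_st_homr (A A' B B' C C' : ob M) (f : hom A A') (g : hom B B') (h : hom C C') :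
  <|phi f (st_hom T g h)|>
  = (fmap (L A') (fmap (L B') <|id2 h|>) *h fmap (R C) <|phi f g|>)
    *v (<|phi f (sf_hom (L B') h)|> *h fmap (L A) (fmap (R C) <|id2 g|>)).
Proof. unfold st_hom; now rewrite pk_phi_compr, pk_phi_R, pk_L, pk_R. Qed.

(* In [h' g' f' h g f], both sides first bring [f'] past [h]; then [g'] past [h] and
   [f'] past [g] take place in disjoint parts of the word. *)
Lemma Phi_tensor (A A' A'' B B' B'' C C' C'' : ob M)
    (f' : hom A' A'') (g' : hom B' B'') (h' : hom C' C'')
    (f : hom A A') (g : hom B B') (h : hom C C') :
  st_cell T (Phi f' g' f g) (id2 (h' o1 h))
    o2 Phi (st_hom T f' g') h' (st_hom T f g) h
  =2= st_cell T (id2 (f' o1 f)) (Phi g' h' g h)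
    o2 Phi f' (st_hom T g' h') f (st_hom T g h).
Proof.
  apply pk_inj; rewrite !pk_vcomp, !pk_st_cell, !fmap_Phi.
  rewrite (pk_Phi (st_hom T f' g')), (pk_Phi f'), !fmap_st_hom.
  rewrite pk_phi_st_homl, pk_phi_st_homr.
  rewrite whisker; [|idem|idem|eapply defined_eq, pk_phi_st_homl].
  rewrite whisker; [|idem|idem|eapply defined_eq, pk_phi_st_homr].
  rewrite !pk_comp1, !fmap_pk_hmul.
  assert (e := slide_whisker (sf_cell (L A'') (phi g' h)) (sf_cell (R C) (phi f' g))
    (idem_fmap (L A'') (idem_fmap (L B'') (idem_id2 h')))
    (idem_fmap (R C) (idem_fmap (R B) (idem_id2 f)))).
  rewrite !pk_L, !pk_R, !pk_comp1, !fmap_pk_hmul, !pk_L, !pk_R in e;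
    rewrite !(pk_sf_cell (L A'')), !(pk_sf_cell (R C)) in e.
  rewrite !fmap_LR, !hmulA in e.
  (* Normal form: functors of a tensor product of objects are split, and every [R] is moved outside
     every [L]. Both sides then become words in the same letters. *)
  rewrite <- !fmap_LL, <- !fmap_RR, !fmap_LR, !hmulA.
  now rewrite <- !vmulA, e.
Qed.

Lemma tensor_unitl : comppf tensor (prodpf unit (idpf M)) = sndpf terminal M.
Proof.
  apply pseudofunctor_ext; cbn.
  - intros [[] A]; apply HT.
  - intros [[] A] [[] B] [[] f]; cbn in *; apply pk_id2_inj.
    now rewrite pk_st_hom, fmap_R_id1, fmap_L1, (st_unitl HT A), hmul_idr.
  - intros [[] A] [[] B] [[] f] [[] g] [[] a]; cbn in *; apply pk_inj.
    now rewrite pk_st_cell, fmap_R_id1, fmap_L1, (st_unitl HT A), hmul_idr.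
  - intros [[] A] [[] B] [[] C] [[] g] [[] f]; cbn in *; apply pk_inj.
    rewrite pk_vcomp, (pk_eq (Phi_id_l _ _ _)), pk_st_cell, pk_eq_cell, (comp1_idl HM).
    rewrite !pk_comp1, !pk_st_hom, !fmap_R_id1, !fmap_L1, !(st_unitl HT).
    rewrite !hmul_idr, hmulA, hmul_idr.
    rewrite <- !pk_comp1; apply vmul_idl.
  - intros [[] A]; cbn in *; apply pk_inj.
    rewrite pk_vcomp, pk_st_cell, fmap_R_id1, pk_eq_cell.
    rewrite (st_unitl HT), fmap_L1, hmul_idr; apply vmul_idl.
Qed.

Lemma tensor_unitr : comppf tensor (prodpf (idpf M) unit) = fstpf M terminal.
Proof.
  apply pseudofunctor_ext; cbn.
  - intros [A []]; apply HT.
  - intros [A []] [B []] [f []]; cbn in *; apply pk_id2_inj.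
    now rewrite pk_st_hom, fmap_L_id1, fmap_R1, (st_unitr HT B), hmul_idl.
  - intros [A []] [B []] [f []] [g []] [a []]; cbn in *; apply pk_inj.
    now rewrite pk_st_cell, fmap_L_id1, fmap_R1, (st_unitr HT B), hmul_idl.
  - intros [A []] [B []] [C []] [g []] [f []]; cbn in *; apply pk_inj.
    rewrite pk_vcomp, (pk_eq (Phi_id_r _ _ _)), pk_st_cell, pk_eq_cell, (comp1_idl HM).
    rewrite !pk_comp1, !pk_st_hom, !fmap_L_id1, !fmap_R1, !(st_unitr HT).
    rewrite !hmul_idl, <- hmulA, hmul_idl.
    rewrite <- !pk_comp1; apply vmul_idl.
  - intros [A []]; cbn in *; apply pk_inj.
    rewrite pk_vcomp, pk_st_cell, fmap_L_id1, pk_eq_cell.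
    rewrite (st_unitr HT), fmap_R1, hmul_idl; apply vmul_idl.
Qed.

Lemma tensor_assoc : comppf tensor (prodpf tensor (idpf M))
    = comppf (comppf tensor (prodpf (idpf M) tensor)) (assocpf M M M).
Proof.
  apply pseudofunctor_ext; cbn.
  - intros [[A B] C]; apply HT.
  - intros [[A B] C] [[A' B'] C'] [[f g] h]; cbn in *; apply pk_id2_inj.
    rewrite (pk_st_hom (st_hom T f g)), (pk_st_hom f (st_hom T g h)).
    now rewrite !fmap_st_hom, fmap_LL, <- fmap_RR, fmap_LR, hmulA.
  - intros [[A B] C] [[A' B'] C'] [[f g] h] [[f' g'] h'] [[a b] c]; cbn in *; apply pk_inj.
    rewrite (pk_st_cell (st_cell T a b)), (pk_st_cell a (st_cell T b c)).
    now rewrite !fmap_st_cell, fmap_LL, <- fmap_RR, fmap_LR, hmulA.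
  - intros [[A B] C] [[A' B'] C'] [[A'' B''] C''] [[f' g'] h'] [[f g] h];
      cbn in *; apply pk_inj.
    rewrite !st_cell_id2, (vcomp_idl HM); apply pk_eq, Phi_tensor.
  - intros [[A B] C]; cbn; apply pk_inj.
    rewrite !st_cell_id2, (vcomp_idl HM), !pk_eqr, !pk_st_cell, !pk_eq_cell.
    now rewrite !fmap_L_id1, !fmap_R_id1, !hmul_idl, (st_assoc HT).
Qed.

Definition extension : semistrict M.
Proof.
  apply (Semistrict tensor_assoc tensor_unitl tensor_unitr).
  split; cbn; intros.
  - apply Phi_id_l.
  - apply Phi_id_r.
  - apply mor2_eq_cell.
Defined.

Lemma extension_restricts : restricts_to extension T.
Proof.
  split; cbn; intros; try reflexivity.
  - apply pk_id2_inj; now rewrite pk_st_hom, fmap_R_id1, <- pk_L, hmul_idr.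
  - apply pk_inj; now rewrite pk_st_cell, fmap_R_id1, <- pk_sf_cell, hmul_idr.
  - apply pk_id2_inj; now rewrite pk_st_hom, fmap_L_id1, <- pk_R, hmul_idl.
  - apply pk_inj; now rewrite pk_st_cell, fmap_L_id1, <- pk_sf_cell, hmul_idl.
  - apply pk_inj; now rewrite pk_Phi, fmap_L_id1, fmap_R_id1, hmul_idl, hmul_idr.
Qed.

End Extension.

Lemma pk_is_id2_src (M : twocat) (A B : ob M) (f g : hom A B) (a : cell f g) :
  is_id2 a -> <|a|> = <|id2 f|>.
Proof. apply pk_eq. Qed.

Lemma pk_is_id2_tgt (M : twocat) (A B : ob M) (f g : hom A B) (a : cell f g) :
  is_id2 a -> <|a|> = <|id2 g|>.
Proof.
  intros H; rewrite (pk_is_id2_src H); apply pk_id2.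
  symmetry; exact (mor2_tgt_eq H).
Qed.

Lemma is_id2_eq (M : twocat) (A B : ob M) (f g : hom A B) (a : cell f g) :
  is_id2 a -> g = f.
Proof. intros H; exact (mor1_inj (mor2_tgt_eq H)). Qed.

Lemma is_id2_intro (M : twocat) (A B : ob M) (f g k : hom A B) (a : cell f g) :
  <|a|> = <|id2 k|> -> is_id2 a.
Proof.
  intros e%pk_inj; pose proof (mor1_inj (mor2_src_eq e)); subst k; exact e.
Qed.

Lemma is_id2_hcomp (M : twocat) (A B C : ob M) (g g' : hom B C) (f f' : hom A B)
    (b : cell g g') (a : cell f f') : is_id2 b -> is_id2 a -> is_id2 (b ** a).
Proof.
  intros Hb Ha; apply (is_id2_intro (k := g o1 f)).
  now rewrite pk_hcomp, pk_comp1, (pk_is_id2_src Hb), (pk_is_id2_src Ha).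
Qed.

Lemma is_id2_id2 (M : twocat) (A B : ob M) (f : hom A B) : is_id2 (id2 f).
Proof. reflexivity. Qed.

Lemma pk_vcomp_idl (M : twocat) (A B : ob M) (f g h : hom A B) (b : cell g h) (a : cell f g) :
  is_id2 b -> <|b o2 a|> = <|a|>.
Proof. intros H; rewrite pk_vcomp, (pk_is_id2_src H); apply vmul_idl. Qed.

Lemma pk_vcomp_idr (M : twocat) (A B : ob M) (f g h : hom A B) (b : cell g h) (a : cell f g) :
  is_id2 a -> <|b o2 a|> = <|b|>.
Proof. intros H; rewrite pk_vcomp, (pk_is_id2_tgt H); apply vmul_idr. Qed.

(** * From a cubical tensor product to interchangors *)

Section Restriction.

Variables (M : twocat) (S : semistrict M).
Let HM := twocatP M.
Let F := ss_tensor S.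
Let HF := pfP F.
Let HC := ss_cubical S.

Definition ten0 (A B : ob M) : ob M := F (A, B).

Definition ten1 (A A' B B' : ob M) (f : hom A A') (g : hom B B') :
    hom (ten0 A B) (ten0 A' B') :=
  pf_hom F (A := (A, B)) (B := (A', B')) (f, g).

Definition ten2 (A A' B B' : ob M) (f f' : hom A A') (g g' : hom B B')
    (a : cell f f') (b : cell g g') : cell (ten1 f g) (ten1 f' g') :=
  pf_cell F (A := (A, B)) (B := (A', B')) (f := (f, g)) (g := (f', g')) (a, b).

Definition coh (A A' A'' B B' B'' : ob M)
    (f' : hom A' A'') (g' : hom B' B'') (f : hom A A') (g : hom B B') :
    cell (ten1 f' g' o1 ten1 f g) (ten1 (f' o1 f) (g' o1 g)) :=
  pf_comp F (A := (A, B)) (B := (A', B')) (E := (A'', B'')) (f', g') (f, g).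

Definition ten (X Y : option (mor2 M)) : option (mor2 M) :=
  match X, Y with
  | Some x, Some y => <|ten2 (mor2_cell x) (mor2_cell y)|>
  | _, _ => None
  end.

Lemma pk_ten2 (A A' B B' : ob M) (f f' : hom A A') (g g' : hom B B')
    (a : cell f f') (b : cell g g') : <|ten2 a b|> = ten <|a|> <|b|>.
Proof. reflexivity. Qed.

Lemma ten2_id2 (A A' B B' : ob M) (f : hom A A') (g : hom B B') :
  ten2 (id2 f) (id2 g) = id2 (ten1 f g).
Proof. exact (pf_id2 HF (A := (A, B)) (B := (A', B')) (f, g)). Qed.

Lemma pk_ten1 (A A' B B' : ob M) (f : hom A A') (g : hom B B') :
  <|id2 (ten1 f g)|> = ten <|id2 f|> <|id2 g|>.
Proof. now rewrite <- ten2_id2. Qed.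

Lemma ten2_vcomp (A A' B B' : ob M) (f f' f'' : hom A A') (g g' g'' : hom B B')
    (a' : cell f' f'') (a : cell f f') (b' : cell g' g'') (b : cell g g') :
  ten2 (a' o2 a) (b' o2 b) = ten2 a' b' o2 ten2 a b.
Proof.
  exact (pf_vcomp HF (A := (A, B)) (B := (A', B')) (f := (f, g)) (g := (f', g'))
    (h := (f'', g'')) (a', b') (a, b)).
Qed.

Lemma is_id2_ten2 (A A' B B' : ob M) (f f' : hom A A') (g g' : hom B B')
    (a : cell f f') (b : cell g g') : is_id2 a -> is_id2 b -> is_id2 (ten2 a b).
Proof.
  intros Ha Hb; apply (is_id2_intro (k := ten1 f g)).
  now rewrite pk_ten2, pk_ten1, (pk_is_id2_src Ha), (pk_is_id2_src Hb).
Qed.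

Lemma coh_idl (A A' B B' B'' : ob M) (g' : hom B' B'') (f : hom A A') (g : hom B B') :
  is_id2 (coh (id1 A') g' f g).
Proof. exact (cubical_l HC f g g'). Qed.

Lemma coh_idr (A A' A'' B B' : ob M) (f' : hom A' A'') (g' : hom B B') (f : hom A A') :
  is_id2 (coh f' g' f (id1 B)).
Proof. exact (cubical_r HC f f' g'). Qed.

(** An identity coherence cell has equal source and target; strictness of [L] and [R] on composites
    of 1-morphisms comes from this. *)
Lemma ten1_compr (A A' B B' B'' : ob M) (g' : hom B' B'') (f : hom A A') (g : hom B B') :
  ten1 f (g' o1 g) = ten1 (id1 A') g' o1 ten1 f g.
Proof. rewrite <- (is_id2_eq (coh_idl g' f g)), (comp1_idl HM); reflexivity. Qed.

Lemma ten1_compl (A A' A'' B B' : ob M) (f' : hom A' A'') (g' : hom B B') (f : hom A A') :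
  ten1 (f' o1 f) g' = ten1 f' g' o1 ten1 f (id1 B).
Proof. rewrite <- (is_id2_eq (coh_idr f' g' f)), (comp1_idr HM); reflexivity. Qed.

Lemma ten1_id1 (A B : ob M) : ten1 (id1 A) (id1 B) = id1 (ten0 A B).
Proof. exact (is_id2_eq (cubical_unit HC A B)). Qed.

Lemma ten_id1 (A B : ob M) :
  ten <|id2 (id1 A)|> <|id2 (id1 B)|> = <|id2 (id1 (ten0 A B))|>.
Proof. now rewrite <- pk_ten1, ten1_id1. Qed.

Lemma coh_natural (A A' A'' B B' B'' : ob M)
    (f1' f2' : hom A' A'') (g1' g2' : hom B' B'') (f1 f2 : hom A A') (g1 g2 : hom B B')
    (a' : cell f1' f2') (b' : cell g1' g2') (a : cell f1 f2) (b : cell g1 g2) :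
  coh f2' g2' f2 g2 o2 (ten2 a' b' ** ten2 a b)
  = ten2 (a' ** a) (b' ** b) o2 coh f1' g1' f1 g1.
Proof.
  exact (pf_comp_natural HF (A := (A, B)) (B := (A', B')) (E := (A'', B''))
    (g := (f1', g1')) (g' := (f2', g2')) (f := (f1, g1)) (f' := (f2, g2)) (a', b') (a, b)).
Qed.

Lemma coh_assoc (A0 A1 A2 A3 B0 B1 B2 B3 : ob M)
    (h1 : hom A2 A3) (h2 : hom B2 B3) (g1 : hom A1 A2) (g2 : hom B1 B2)
    (f1 : hom A0 A1) (f2 : hom B0 B1) :
  coh (h1 o1 g1) (h2 o1 g2) f1 f2 o2 (coh h1 h2 g1 g2 ** id2 (ten1 f1 f2))
  =2= coh h1 h2 (g1 o1 f1) (g2 o1 f2) o2 (id2 (ten1 h1 h2) ** coh g1 g2 f1 f2).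
Proof.
  exact (pf_comp_assoc HF (A := (A0, B0)) (B := (A1, B1)) (E := (A2, B2)) (G := (A3, B3))
    (h1, h2) (g1, g2) (f1, f2)).
Qed.

(** Naturality of [coh] at a place where cubicality makes both coherence cells identities. *)
Lemma ten_hmulr (A A' B B' B'' : ob M) (f f' : hom A A') (g1 g1' : hom B' B'')
    (g g' : hom B B') (a : cell f f') (b1 : cell g1 g1') (b : cell g g') :
  ten <|a|> (<|b1|> *h <|b|>) = ten <|id2 (id1 A')|> <|b1|> *h ten <|a|> <|b|>.
Proof.
  assert (e := f_equal (fun c => <|c|>) (coh_natural (id2 (id1 A')) b1 a b)); cbn beta in e.
  rewrite pk_vcomp_idl, pk_vcomp_idr in e; try apply coh_idl.
  rewrite pk_ten2, !pk_hcomp, hmul_idl in e; now rewrite <- e.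
Qed.

Lemma ten_hmull (A A' A'' B B' : ob M) (f1 f1' : hom A' A'') (f f' : hom A A')
    (g g' : hom B B') (a1 : cell f1 f1') (a : cell f f') (b : cell g g') :
  ten (<|a1|> *h <|a|>) <|b|> = ten <|a1|> <|b|> *h ten <|a|> <|id2 (id1 B)|>.
Proof.
  assert (e := f_equal (fun c => <|c|>) (coh_natural a1 b a (id2 (id1 B)))); cbn beta in e.
  rewrite pk_vcomp_idl, pk_vcomp_idr in e; try apply coh_idr.
  rewrite pk_ten2, !pk_hcomp, hmul_idr in e; now rewrite <- e.
Qed.

Lemma coh_eq (A A' A'' B B' B'' C C' C'' D D' D'' : ob M)
    (f' : hom A' A'') (g' : hom B' B'') (f : hom A A') (g : hom B B')
    (h' : hom C' C'') (k' : hom D' D'') (h : hom C C') (k : hom D D') :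
  f' =1= h' -> g' =1= k' -> f =1= h -> g =1= k ->
  <|coh f' g' f g|> = <|coh h' k' h k|>.
Proof.
  intros e1 e2 e3 e4.
  pose proof (f_equal (@mor1_src M) e1); pose proof (f_equal (@mor1_tgt M) e1).
  pose proof (f_equal (@mor1_src M) e2); pose proof (f_equal (@mor1_tgt M) e2).
  pose proof (f_equal (@mor1_src M) e3); pose proof (f_equal (@mor1_src M) e4).
  cbn in *; subst.
  apply mor1_inj in e1, e2, e3, e4; now subst.
Qed.

(** Associativity at [(f', g')], [(id, g)], [(f, id)]; cubicality removes one cell on each side. *)
Lemma coh_split (A A' A'' B B' B'' : ob M)
    (f' : hom A' A'') (g' : hom B' B'') (f : hom A A') (g : hom B B') :
  <|coh f' g' f g|> = <|coh f' g' (id1 A') g|> *h <|id2 (ten1 f (id1 B))|>.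
Proof.
  assert (e := pk_eq (coh_assoc f' g' (id1 A') g f (id1 B))).
  rewrite pk_vcomp_idl in e by apply coh_idr.
  rewrite pk_vcomp_idr in e by (apply is_id2_hcomp; [apply is_id2_id2|apply coh_idl]).
  now rewrite <- pk_hcomp, e, (comp1_idl HM), (comp1_idr HM).
Qed.

(** Associativity at [(id, g')], [(f, id)], [(id, g)], again with one cell removed on each side. *)
Lemma coh_split_id (A A'' B B' B'' : ob M)
    (f : hom A A'') (g' : hom B' B'') (g : hom B B') :
  <|coh f g' (id1 A) g|> = <|id2 (ten1 (id1 A'') g')|> *h <|coh f (id1 B') (id1 A) g|>.
Proof.
  assert (e := pk_eq (coh_assoc (id1 A'') g' f (id1 B') (id1 A) g)).
  rewrite pk_vcomp_idr in e by (apply is_id2_hcomp; [apply coh_idl|apply is_id2_id2]).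
  rewrite pk_vcomp_idl in e by apply coh_idl.
  now rewrite <- pk_hcomp, <- e, (comp1_idl HM f), (comp1_idr HM g').
Qed.

Lemma coh_interchangor (A A' A'' B B' B'' : ob M)
    (f' : hom A' A'') (g' : hom B' B'') (f : hom A A') (g : hom B B') :
  <|coh f' g' f g|> = <|id2 (ten1 (id1 A'') g')|> *h <|coh f' (id1 B') (id1 A') g|>
    *h <|id2 (ten1 f (id1 B))|>.
Proof. now rewrite coh_split, coh_split_id. Qed.

Lemma ten0_assoc (A B C : ob M) : ten0 (ten0 A B) C = ten0 A (ten0 B C).
Proof.
  exact (f_equal (fun G : pseudofunctor (prod_twocat (prod_twocat M M) M) M =>
    G ((A, B), C)) (ss_assoc S)).
Qed.

(** [ss_assoc] is used through an observation valued in packed 2-morphisms, a type independent of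
    the pseudofunctor, so no transport appears. *)
Lemma ten_assoc X Y Z : ten (ten X Y) Z = ten X (ten Y Z).
Proof.
  destruct X as [[A A' f f' a]|], Y as [[B B' g g' b]|], Z as [[C C' h h' c]|]; try reflexivity.
  exact (f_equal (fun G : pseudofunctor (prod_twocat (prod_twocat M M) M) M =>
    <|pf_cell G (A := ((A, B), C)) (B := ((A', B'), C')) (f := ((f, g), h))
        (g := ((f', g'), h')) ((a, b), c)|>) (ss_assoc S)).
Qed.

(** The coherence component of [ss_assoc]; with identities inserted it yields all three
    compatibilities of the interchangor with [L] and [R]. *)
Lemma coh_tensor (A A' A'' B B' B'' C C' C'' : ob M)
    (f' : hom A' A'') (g' : hom B' B'') (h' : hom C' C'')
    (f : hom A A') (g : hom B B') (h : hom C C') :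
  ten2 (coh f' g' f g) (id2 (h' o1 h)) o2 coh (ten1 f' g') h' (ten1 f g) h
  =2= ten2 (id2 (f' o1 f)) (coh g' h' g h) o2 coh f' (ten1 g' h') f (ten1 g h).
Proof.
  (* Composition with [assocpf] contributes an extra outer factor, the image of the identity
     coherences of [assocpf]. *)
  transitivity (Mor2 (ten2 (id2 (f' o1 f)) (ten2 (id2 (g' o1 g)) (id2 (h' o1 h)))
    o2 (ten2 (id2 (f' o1 f)) (coh g' h' g h) o2 coh f' (ten1 g' h') f (ten1 g h)))).
  - exact (f_equal (fun G : pseudofunctor (prod_twocat (prod_twocat M M) M) M =>
      Mor2 (pf_comp G (A := ((A, B), C)) (B := ((A', B'), C')) (E := ((A'', B''), C''))
        ((f', g'), h') ((f, g), h))) (ss_assoc S)).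
  - now rewrite !ten2_id2, (vcomp_idl HM).
Qed.

Definition one : ob M := ss_unit S tt.
(** A pseudofunctor need not preserve identities strictly, so a priori this is only isomorphic to
    [id1 one]. *)
Definition one1 : hom one one := pf_hom (ss_unit S) (A := tt) (B := tt) tt.

Lemma unit_cell : pf_cell (ss_unit S) (A := tt) (B := tt) (f := tt) (g := tt) tt = id2 one1.
Proof. exact (pf_id2 (pfP (ss_unit S)) (A := tt) (B := tt) tt). Qed.

Lemma ten0_onel (A : ob M) : ten0 one A = A.
Proof.
  exact (f_equal (fun G : pseudofunctor (prod_twocat terminal M) M => G (tt, A)) (ss_unitl S)).
Qed.

Lemma ten0_oner (A : ob M) : ten0 A one = A.
Proof.
  exact (f_equal (fun G : pseudofunctor (prod_twocat M terminal) M => G (A, tt)) (ss_unitr S)).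
Qed.

Lemma ten_one1l X : ten <|id2 one1|> X = X.
Proof.
  destruct X as [[A A' f f' a]|]; [|reflexivity].
  rewrite <- unit_cell.
  exact (f_equal (fun G : pseudofunctor (prod_twocat terminal M) M =>
    <|pf_cell G (A := (tt, A)) (B := (tt, A')) (f := (tt, f)) (g := (tt, f')) (tt, a)|>)
    (ss_unitl S)).
Qed.

Lemma ten_one1r X : ten X <|id2 one1|> = X.
Proof.
  destruct X as [[A A' f f' a]|]; [|reflexivity].
  rewrite <- unit_cell.
  exact (f_equal (fun G : pseudofunctor (prod_twocat M terminal) M =>
    <|pf_cell G (A := (A, tt)) (B := (A', tt)) (f := (f, tt)) (g := (f', tt)) (a, tt)|>)
    (ss_unitr S)).
Qed.

(* An Eckmann-Hilton argument: [one1] is [one1 (x) one1 = (id (x) one1) o (one1 (x) id)],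
   and both factors are identities. *)
Lemma one1_id1 : one1 = id1 one.
Proof.
  apply mor1_inj, pk_id2_inj.
  transitivity (ten <|id2 one1|> (<|id2 one1|> *h <|id2 (id1 one)|>)).
  - now rewrite hmul_idr, ten_one1l.
  - now rewrite ten_hmulr, ten_one1l, ten_one1r, hmul_idl.
Qed.

Lemma ten_onel X : ten <|id2 (id1 one)|> X = X.
Proof. rewrite <- one1_id1; apply ten_one1l. Qed.

Lemma ten_oner X : ten X <|id2 (id1 one)|> = X.
Proof. rewrite <- one1_id1; apply ten_one1r. Qed.

(** Tensoring with [id1 one] on the left changes nothing, and [id1 one] tensored with this cell is,
    up to the trivial unit cell of the tensor product, the unit coherence of the composite in
    [ss_unitr]; that equation makes it an identity. *)
Lemma unit_unit : is_id2 (pf_unit (ss_unit S) tt).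
Proof.
  apply (is_id2_intro (k := id1 one)).
  transitivity (ten <|id2 (id1 one)|> <|pf_unit (ss_unit S) tt|>); [symmetry; apply ten_onel|].
  assert (e := f_equal (fun G : pseudofunctor (prod_twocat M terminal) M =>
    <|pf_unit G (one, tt)|>) (ss_unitr S)); cbn in e.
  rewrite pk_vcomp_idr in e by apply (cubical_unit HC).
  exact e.
Qed.

Lemma unit_comp : is_id2 (pf_comp (ss_unit S) (A := tt) (B := tt) (E := tt) tt tt).
Proof.
  assert (e := pk_eq (pf_comp_unitl (pfP (ss_unit S)) (A := tt) (B := tt) tt)).
  rewrite pk_vcomp_idr in e by (apply is_id2_hcomp; [apply unit_unit|apply is_id2_id2]).
  exact (is_id2_intro e).
Qed.

Definition restr_L (A : ob M) : strict_ext M M (fun B => ten0 A B).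
Proof.
  refine (@StrictExt M M _ (fun B B' g => ten1 (id1 A) g)
    (fun B B' g g' b => ten2 (id2 (id1 A)) b) _ _ _ _ _); intros.
  - apply ten1_id1.
  - apply ten1_compr.
  - apply ten2_id2.
  - now rewrite <- ten2_vcomp, (vcomp_idl HM).
  - apply pk_inj; rewrite pk_ten2, !pk_hcomp; apply ten_hmulr.
Defined.

Definition restr_R (B : ob M) : strict_ext M M (fun A => ten0 A B).
Proof.
  refine (@StrictExt M M (fun A => ten0 A B) (fun A A' f => ten1 f (id1 B))
    (fun A A' f f' a => ten2 a (id2 (id1 B))) _ _ _ _ _); intros.
  - apply ten1_id1.
  - apply ten1_compl.
  - apply ten2_id2.
  - now rewrite <- ten2_vcomp, (vcomp_idl HM).
  - apply pk_inj; rewrite pk_ten2, !pk_hcomp; apply ten_hmull.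
Defined.

(** The coherence cell ends at the tensor product of [f] and [g]. That this is the nudged composite
    is cubicality at [(id, g)], [(f, id)], in the form of [ten1_compr]. *)
Lemma restr_phi_tgt (A A' B B' : ob M) (f : hom A A') (g : hom B B') :
  ten1 (f o1 id1 A) (id1 B' o1 g) = ten1 (id1 A') g o1 ten1 f (id1 B).
Proof.
  rewrite (comp1_idr HM f), (comp1_idl HM g), <- ten1_compr.
  now rewrite (comp1_idr HM g).
Qed.

Definition restr_data : stringent_data M :=
  @StringentData M one ten0 restr_L restr_R
    (fun A A' B B' f g => eq_cell (restr_phi_tgt f g) o2 coh f (id1 B') (id1 A) g).

Lemma pk_restr_phi (A A' B B' : ob M) (f : hom A A') (g : hom B B') :
  <|st_phi restr_data f g|> = <|coh f (id1 B') (id1 A) g|>.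
Proof. apply pk_eql. Qed.

Lemma coh_iso (A A' A'' B B' B'' : ob M)
    (f' : hom A' A'') (g' : hom B' B'') (f : hom A A') (g : hom B B') :
  is_iso2 (coh f' g' f g).
Proof. apply HF. Qed.

Lemma ten_L_R (A A' B B' : ob M) (f f' : hom A A') (g g' : hom B B')
    (a : cell f f') (b : cell g g') :
  ten <|id2 (id1 A')|> <|b|> *h ten <|a|> <|id2 (id1 B)|> = ten <|a|> <|b|>.
Proof. now rewrite <- ten_hmulr, hmul_idr. Qed.

Lemma ten_R_L (A A' B B' : ob M) (f f' : hom A A') (g g' : hom B B')
    (a : cell f f') (b : cell g g') :
  ten2 (a ** id2 (id1 A)) (id2 (id1 B') ** b) =2= ten2 a b.
Proof. apply pk_inj; now rewrite !pk_ten2, !pk_hcomp, hmul_idl, hmul_idr. Qed.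

Lemma restr_laws : is_stringent restr_data.
Proof.
  split.
  - apply ten0_assoc.
  - apply ten0_onel.
  - apply ten0_oner.
  - intros A B; apply strict_functor_ext; cbn; intros.
    + symmetry; apply ten0_assoc.
    + apply pk_id2_inj; now rewrite !pk_ten1, <- ten_assoc, ten_id1.
    + apply pk_inj; now rewrite !pk_ten2, <- ten_assoc, ten_id1.
  - intros A B; apply strict_functor_ext; cbn; intros.
    + apply ten0_assoc.
    + apply pk_id2_inj; now rewrite !pk_ten1, ten_assoc, ten_id1.
    + apply pk_inj; now rewrite !pk_ten2, ten_assoc, ten_id1.
  - intros A B; apply strict_functor_ext; cbn; intros.
    + symmetry; apply ten0_assoc.
    + apply pk_id2_inj; now rewrite !pk_ten1, ten_assoc.
    + apply pk_inj; now rewrite !pk_ten2, ten_assoc.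
  - apply strict_functor_ext; cbn; intros.
    + apply ten0_onel.
    + apply pk_id2_inj; now rewrite pk_ten1, ten_onel.
    + apply pk_inj; now rewrite pk_ten2, ten_onel.
  - apply strict_functor_ext; cbn; intros.
    + apply ten0_oner.
    + apply pk_id2_inj; now rewrite pk_ten1, ten_oner.
    + apply pk_inj; now rewrite pk_ten2, ten_oner.
  - intros; apply is_iso2_vcomp; [apply is_iso2_eq_cell|apply coh_iso].
  - intros; apply pk_inj; rewrite pk_restr_phi; cbn.
    (* Here and in the next two cases, the two morphisms to be exchanged occupy two of the three
       tensor slots, the left one in the outer triple and the right one in the inner triple; all
       other entries are identities. One cell on each side survives. *)
    assert (e := pk_eq (coh_tensor (id1 A) g (id1 C') (id1 A) (id1 B) h)).
    rewrite pk_vcomp_idl, pk_vcomp_idr in e;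
      try apply coh_idl; try (apply is_id2_ten2; [apply coh_idl|apply is_id2_id2]).
    rewrite ten1_id1 in e; rewrite e, pk_ten2, pk_comp1, hmul_idl.
    now rewrite <- pk_restr_phi.
  - intros; apply pk_inj; rewrite !pk_restr_phi; cbn.
    assert (e := pk_eq (coh_tensor f (id1 B) (id1 C') (id1 A) (id1 B) h)).
    rewrite !pk_vcomp_idl in e;
      try (apply is_id2_ten2; [apply coh_idr|apply is_id2_id2]);
      try (apply is_id2_ten2; [apply is_id2_id2|apply coh_idl]).
    now rewrite !ten1_id1 in e.
  - intros; apply pk_inj; rewrite !pk_restr_phi; cbn.
    assert (e := pk_eq (coh_tensor f (id1 B') (id1 C) (id1 A) g (id1 C))).
    rewrite pk_vcomp_idr, pk_vcomp_idl in e;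
      try apply coh_idr; try (apply is_id2_ten2; [apply is_id2_id2|apply coh_idl]).
    rewrite ten1_id1 in e; rewrite <- e, pk_ten2, pk_comp1, hmul_idl.
    now rewrite <- pk_restr_phi.
  - intros; apply pk_inj; rewrite pk_restr_phi; apply pk_is_id2_src, coh_idr.
  - intros; apply pk_inj; rewrite pk_restr_phi; apply pk_is_id2_src, coh_idl.
  - intros; apply mor2_inj, pk_inj; rewrite !pk_vcomp, !pk_restr_phi; cbn.
    assert (e := f_equal (fun c => <|c|>)
      (coh_natural a (id2 (id1 B')) (id2 (id1 A)) (id2 g))); cbn beta in e.
    rewrite !pk_vcomp, (pk_eq (ten_R_L a (id2 g))), pk_ten2, <- ten_L_R, ten2_id2 in e.
    now rewrite e, pk_hcomp, pk_ten1, pk_ten2.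
  - intros; apply mor2_inj, pk_inj; rewrite !pk_vcomp, !pk_restr_phi; cbn.
    assert (e := f_equal (fun c => <|c|>)
      (coh_natural (id2 f) (id2 (id1 B')) (id2 (id1 A)) b)); cbn beta in e.
    rewrite !pk_vcomp, (pk_eq (ten_R_L (id2 f) b)), pk_ten2, <- ten_L_R, ten2_id2 in e.
    now rewrite e, pk_hcomp, pk_ten1, pk_ten2.
  - intros; apply pk_inj; unfold assoc_cell.
    rewrite pk_vcomp, pk_eqr, !pk_hcomp, !pk_restr_phi; cbn.
    (* Associativity at [(f, id)], [(id, g')], [(id, g)]; the remaining mixed cell is an
       interchangor whiskered by [g'], by [coh_split_id]. The last axiom is dual, with
       [coh_split]. *)
    assert (e := pk_eq (coh_assoc f (id1 B'') (id1 A) g' (id1 A) g)).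
    rewrite (pk_vcomp_idr (coh f _ (id1 A o1 id1 A) _)) in e
      by (apply is_id2_hcomp; [apply is_id2_id2|apply coh_idl]).
    rewrite (comp1_idl HM (id1 A)) in e; rewrite <- e, pk_vcomp, pk_hcomp.
    rewrite <- coh_split_id; f_equal; apply coh_eq;
      now rewrite ?(comp1_idl HM), ?(comp1_idr HM).
  - intros; apply pk_inj; unfold assoc_cell_inv.
    rewrite pk_vcomp, pk_eqr, !pk_hcomp, !pk_restr_phi; cbn.
    assert (e := pk_eq (coh_assoc f' (id1 B') f (id1 B') (id1 A) g)).
    rewrite pk_vcomp_idr in e by (apply is_id2_hcomp; [apply coh_idr|apply is_id2_id2]).
    rewrite (comp1_idl HM (id1 B')) in e; rewrite e, pk_vcomp, pk_hcomp.
    rewrite <- coh_split; f_equal; apply coh_eq; now rewrite ?(comp1_idl HM), ?(comp1_idr HM).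
Qed.

Definition restriction : stringent M := Stringent restr_laws.

Lemma restriction_restricts : restricts_to S restriction.
Proof.
  split; try reflexivity; cbn; intros.
  - apply pk_id2_inj; transitivity (<|id2 (ten1 f g)|>); [|reflexivity].
    rewrite pk_ten1, <- ten_L_R, <- !pk_ten1; exact (pk_comp1 _ _).
  - apply pk_inj; transitivity (<|ten2 a b|>); [|reflexivity].
    rewrite pk_ten2, <- ten_L_R; exact (pk_hcomp _ _).
  - apply pk_inj, pk_restr_phi.
Qed.

End Restriction.

(** * Uniqueness on both sides of restriction *)

Lemma restricts_to_uniq_stringent (M : twocat) (S : semistrict M) (T T' : stringent M) :
  restricts_to S T -> restricts_to S T' -> T = T'.
Proof.
  intros H H'; apply stringent_ext; intros; etransitivity;
    (apply H || (symmetry; apply H')).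
Qed.

(** Of the unit pseudofunctor, [restricts_to] records only the object; the rest is forced by
    [one1_id1], [unit_unit] and [unit_comp]. The tensor coherences are forced by
    [coh_interchangor]. *)
Lemma restricts_to_uniq_semistrict (M : twocat) (S S' : semistrict M) (T : stringent M) :
  restricts_to S T -> restricts_to S' T -> S = S'.
Proof.
  intros H H'; apply semistrict_ext.
  - assert (e : one S = one S') by (transitivity (st_unit T); [symmetry; apply H|apply H']).
    assert (ei : id1 (one S) =1= id1 (one S')) by now rewrite e.
    assert (e1 : one1 S =1= one1 S') by now rewrite !one1_id1.
    apply pseudofunctor_ext.
    + intros []; exact e.
    + intros [] [] []; exact e1.
    + intros [] [] [] [] []; apply pk_inj.
      rewrite (unit_cell S), (unit_cell S'); exact (pk_id2 e1).
    + intros [] [] [] [] []; apply pk_inj.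
      rewrite (pk_is_id2_tgt (unit_comp S)), (pk_is_id2_tgt (unit_comp S')).
      exact (pk_id2 e1).
    + intros []; apply pk_inj.
      rewrite (pk_is_id2_src (unit_unit S)), (pk_is_id2_src (unit_unit S')).
      exact (pk_id2 ei).
  - apply pseudofunctor_ext.
    + intros [A B]; transitivity (st_ob T A B); [symmetry; apply H|apply H'].
    + intros [A B] [A' B'] [f g]; transitivity (Mor1 (st_hom T f g));
        [symmetry; apply (res_hom H)|apply (res_hom H')].
    + intros [A B] [A' B'] [f g] [f' g'] [a b]; transitivity (Mor2 (st_cell T a b));
        [symmetry; apply (res_cell H)|apply (res_cell H')].
    + intros [A B] [A' B'] [A'' B''] [f' g'] [f g]; apply pk_inj.
      transitivity (<|coh S f' g' f g|>); [reflexivity|].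
      transitivity (<|coh S' f' g' f g|>); [|reflexivity].
      rewrite (coh_interchangor S f' g'), (coh_interchangor S' f' g').
      f_equal; [f_equal|]; [apply pk_id2|apply pk_eq|apply pk_id2].
      * etransitivity; [symmetry; apply (res_L_hom H)|apply (res_L_hom H')].
      * etransitivity; [symmetry; apply (res_phi H)|apply (res_phi H')].
      * etransitivity; [symmetry; apply (res_R_hom H)|apply (res_R_hom H')].
    + intros [A B]; apply pk_inj.
      rewrite (pk_is_id2_src (cubical_unit (ss_cubical S) A B)).
      rewrite (pk_is_id2_src (cubical_unit (ss_cubical S') A B)); apply pk_id2.
      assert (e : ss_tensor S (A, B) = ss_tensor S' (A, B))
        by (transitivity (st_ob T A B); [symmetry; apply H|apply H']).
      now rewrite e.
Qed.

Theorem proposition9 (M : twocat) :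
  exists (restrict : semistrict M -> stringent M) (extend : stringent M -> semistrict M),
    (forall S : semistrict M, restricts_to S (restrict S)) /\
    (forall T : stringent M, restricts_to (extend T) T) /\
    (forall S : semistrict M, extend (restrict S) = S) /\
    (forall T : stringent M, restrict (extend T) = T).
Proof.
  exists (@restriction M), (@extension M); split; [|split; [|split]].
  - apply restriction_restricts.
  - apply extension_restricts.
  (* Both [S] and its re-extension restrict to [restriction S], so uniqueness applies without
     computing the composite; the other composite is treated likewise. *)
  - intros S; apply (restricts_to_uniq_semistrict (T := restriction S)).
    + apply extension_restricts.
    + apply restriction_restricts.
  - intros T; apply (restricts_to_uniq_stringent (S := extension T)).
    + apply restriction_restricts.
    + apply extension_restricts.
Qed.
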